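(* Let $\nu\ge 2$ be an integer, let $\omega\in\mathbb{R}^{\nu}$ be non-resonant, and let $c,d:\mathbb{Z}^{\nu}\to\mathbb{C}$. Consider the quasi-periodic Cauchy problem $$u_{tt}-u_{xx}-u_{xxtt}-(u^2)_{xx}=0,\qquad u(0,x)=\sum_{n\in\mathbb{Z}^{\nu}}c(n)e^{i\langle n,\omega\rangle x},\qquad u_t(0,x)=\sum_{n\in\mathbb{Z}^{\nu}}d(n)e^{i\langle n,\omega\rangle x},\qquad x\in\mathbb{R}.$$ Assume that there exist $A>0$ and $r>\nu+2$ such that $$|c(n)|\le A(1+|n|)^{-r},\qquad |d(n)|\le A(1+|n|)^{-r},\qquad n\in\mathbb{Z}^{\nu}.$$ Let $$H(r;\nu):=\sum_{m\in\mathbb{Z}^\nu}(1+|m|)^{-r},\qquad K_{r,\nu}:=2^{r+1}H(r;\nu),\qquad M_r:=\max\{1,AK_{r,\nu}\},\qquad L_r:=\frac{1}{5M_r}.$$ Then, on the time interval $[0,L_r]$, the Cauchy problem admits a classical spatially quasi-periodic solution of the form $$u(t,x)=\sum_{n\in\mathbb{Z}^{\nu}}\widehat u(t,n)e^{i\langle n,\omega\rangle x}$$ such that $$|\widehat u(t,n)|\le 2A(1+|n|)^{-r},\qquad 0\le t\le L_r,\ n\in\mathbb{Z}^{\nu}.$$ Moreover, this solution is unique among all spatially quasi-periodic solutions of the Cauchy problem on $[0,L_r]$ (with the same frequency vector $\omega$) satisfying this polynomial decay estimate.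
   Context: For $n=(n_1,\dots,n_\nu)\in\mathbb{Z}^\nu$, $|n|:=\sum_{j=1}^\nu|n_j|$ and $\langle n,\omega\rangle:=\sum_{j=1}^\nu n_j\omega_j$. The vector $\omega\in\mathbb{R}^\nu$ is non-resonant (rationally independent) if $\langle n,\omega\rangle=0$ with $n\in\mathbb{Z}^\nu$ implies $n=0$. A classical spatially quasi-periodic solution on $[0,L]$ with frequency vector $\omega$ is a function $u:[0,L]\times\mathbb{R}\to\mathbb{C}$ of the form $u(t,x)=\sum_{n\in\mathbb{Z}^\nu}\widehat u(t,n)e^{i\langle n,\omega\rangle x}$ for which the derivatives $u_t,u_{tt},u_{xx},u_{xxtt},(u^2)_{xx}$ exist as continuous functions on $[0,L]\times\mathbb{R}$ (one-sided in $t$ at the endpoints), the equation holds pointwise on $[0,L]\times\mathbb{R}$, and the two initial conditions hold pointwise. *)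

(* Defs.v *)
From Stdlib Require Import Reals.
From mathcomp Require Import all_boot all_algebra.
From mathcomp Require Import Rstruct.
From Coquelicot Require Import Coquelicot.

Set Implicit Arguments.
Unset Strict Implicit.
Unset Printing Implicit Defensive.

Local Open Scope R_scope.

(* Unordered summation: the net of finite partial sums, directed by
   inclusion of the finite index sets, converges to [s]. *)
Definition is_usum (T : eqType) (V : NormedModule R_AbsRing)
    (f : T -> V) (s : V) : Prop :=
  forall eps : posreal, exists l0 : seq T, forall l : seq T,
    uniq l -> {subset l0 <= l} ->
    norm (minus (\big[plus/zero]_(n <- l) f n) s) < eps.

(* A total operator in the style of [RInt]; unspecified on non-summable
   families. *)
Definition usum (T : eqType) (V : CompleteNormedModule R_AbsRing)
    (f : T -> V) : V :=
  iota (is_usum f).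

Section Frequencies.
Variable nu : nat.

Definition l1norm (n : 'rV[int]_nu) : nat := (\sum_(j < nu) `|n ord0 j|)%N.

Definition pairing (n : 'rV[int]_nu) (omega : 'rV[R]_nu) : R :=
  (\sum_(j < nu) (n ord0 j)%:~R * omega ord0 j)%R.

Definition nonresonant (omega : 'rV[R]_nu) : Prop :=
  forall n : 'rV[int]_nu, pairing n omega = 0 -> n = 0%R.

Definition weight (r : R) (n : 'rV[int]_nu) : R :=
  Rpower (1 + INR (l1norm n)) (- r).

(* The term a e^{i <n, omega> x}. *)
Definition mode (omega : 'rV[R]_nu) (n : 'rV[int]_nu) (a : C) (x : R) : C :=
  Cmult a (cos (pairing n omega * x), sin (pairing n omega * x)).

Definition is_fourier_sum (omega : 'rV[R]_nu) (a : 'rV[int]_nu -> C)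
    (x : R) (s : C) : Prop :=
  is_usum (V := C_R_NormedModule) (fun n => mode omega n (a n) x) s.

End Frequencies.

Definition Hconst (r : R) (nu : nat) : R :=
  usum (V := R_CompleteNormedModule) (@weight nu r).

Definition Kconst (r : R) (nu : nat) : R := Rpower 2 (r + 1) * Hconst r nu.

Definition Mconst (A r : R) (nu : nat) : R := Rmax 1 (A * Kconst r nu).

Definition lifespan (A r : R) (nu : nat) : R := 1 / (5 * Mconst A r nu).

(* Functions on [0,L] x R are represented by total functions; every notion
   below depends only on their values for 0 <= t <= L. *)
Section Strip.
Variable L : R.

Definition time_interval (t : R) : Prop := 0 <= t <= L.

Definition strip (p : R * R) : Prop := time_interval p.1.

Definition continuous_on_strip (u : R -> R -> C) : Prop :=
  continuous_on (T := prod_UniformSpace R_UniformSpace R_UniformSpace)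
    (U := C_R_NormedModule) strip (fun p => u p.1 p.2).

(* [ut] is the time derivative of [u], taken along [0,L] and hence one-sided
   at the endpoints. *)
Definition is_dt (u ut : R -> R -> C) : Prop :=
  forall t x, time_interval t ->
    filterdiff (U := R_NormedModule) (V := C_R_NormedModule)
      (fun s => u s x) (within time_interval (locally t))
      (fun h => scal h (ut t x)).

Definition is_dx (u ux : R -> R -> C) : Prop :=
  forall t x, time_interval t ->
    is_derive (K := R_AbsRing) (V := C_R_NormedModule)
      (fun y => u t y) x (ux t x).

Definition is_dtt (u utt : R -> R -> C) : Prop :=
  exists ut, is_dt u ut /\ is_dt ut utt.

Definition is_dxx (u uxx : R -> R -> C) : Prop :=
  exists ux, is_dx u ux /\ is_dx ux uxx.

Definition is_classical_solution (nu : nat) (omega : 'rV[R]_nu)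
    (c d : 'rV[int]_nu -> C) (u : R -> R -> C) : Prop :=
  exists ut utt uxx uxxtt u2xx : R -> R -> C,
    (is_dt u ut /\ is_dt ut utt /\ is_dxx u uxx /\ is_dtt uxx uxxtt /\
      is_dxx (fun t x => Cmult (u t x) (u t x)) u2xx) /\
    (continuous_on_strip ut /\ continuous_on_strip utt /\
      continuous_on_strip uxx /\ continuous_on_strip uxxtt /\
      continuous_on_strip u2xx) /\
    (forall t x, time_interval t ->
      (utt t x - uxx t x - uxxtt t x - u2xx t x)%C = RtoC 0) /\
    (forall x, is_fourier_sum omega c x (u 0 x)) /\
    (forall x, is_fourier_sum omega d x (ut 0 x)).

Definition is_quasiperiodic (nu : nat) (omega : 'rV[R]_nu)
    (u : R -> R -> C) (uhat : R -> 'rV[int]_nu -> C) : Prop :=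
  forall t x, time_interval t -> is_fourier_sum omega (uhat t) x (u t x).

Definition is_quasiperiodic_solution (nu : nat) (omega : 'rV[R]_nu)
    (c d : 'rV[int]_nu -> C)
    (u : R -> R -> C) (uhat : R -> 'rV[int]_nu -> C) : Prop :=
  is_quasiperiodic omega u uhat /\ is_classical_solution omega c d u.

Definition has_decay (nu : nat) (A r : R)
    (uhat : R -> 'rV[int]_nu -> C) : Prop :=
  forall t n, time_interval t -> Cmod (uhat t n) <= 2 * A * weight r n.

End Strip.

(* Main.v *)
From HB Require Import structures.
Require Import Defs.
From Stdlib Require Import Reals Lra FunctionalExtensionality.
From mathcomp Require Import all_boot all_algebra.
From mathcomp Require Import Rstruct.
From Coquelicot Require Import Coquelicot.

Set Implicit Arguments.
Unset Strict Implicit.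
Unset Printing Implicit Defensive.

Import GRing.Theory.

Local Open Scope R_scope.

(** With [la = <n, omega>], the Fourier coefficients of a solution obey
      [(1 + la^2) uhat'' = - la^2 (uhat + uhat * uhat)],
    where the star is convolution over the lattice.  The multiplier
    [la^2 / (1 + la^2)] lies in [[0, 1]], so there are no small divisors, and
    the weights satisfy [w * w <= K w] ([weight_conv_le]), so that sequences
    dominated by [w] form an algebra: the system is an ordinary differential
    equation with a bounded quadratic right-hand side.

    Existence.  The coefficients are sought as power series
    [uhat(t, n) = sum_k p_k(n) t^k], which forces
      [(k+2)(k+1) p_(k+2) = - la^2/(1+la^2) (p_k + sum_(i<=k) p_i * p_(k-i))].
    Induction gives [|p_k| <= A M^k w] ([taylor_coef_bound]).  On [[0, L]] with
    [L = 1/(5M)] the series converge with ratio [1/5] and sum to at most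
    [5/4 A w]; they still converge for [|t| <= 1/(4M)], so that all time
    derivatives exist as two-sided ones.  The function [u], its derivatives and
    [u^2] are single absolutely convergent series over [N x Z^nu], which may be
    differentiated term by term ([pseries_dt], [pseries_dx]) and multiplied
    ([pseries_square]); the margin [r > nu + 2] pays for two derivatives in [x].
    The equation then holds coefficient by coefficient.

    Uniqueness.  The time derivatives of a competing solution [v] are known
    pointwise in [x] only, and come without a Fourier expansion.  For each [n],
    though, nonresonance yields finite combinations of point evaluations which
    recover the [n]-th coefficient of all series dominated by a given summable
    sequence up to a small error: averaging a function with its translate by
    [PI / (la_m - la_n)] removes the mode [m] and keeps the mode [n]
    ([evalcomb_coef_approx]).  Such combinations commute with time derivatives.
    For [z = u - v] put [w = z - z_xx]; by the equation,
    [w_tt = z_xx + (u^2 - v^2)_xx] contains no time derivative, hence has a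
    known Fourier series, and Taylor's formula in time descends to the
    coefficients of [w] ([slope_estimate]).  The initial slope of [w] involves
    [z_xxt(0)], on which the initial data say nothing directly; it is
    eliminated by comparing two times, one of which tends to [0], and by using
    that [z] itself has zero initial slope ([coef_sublinear]).  The outcome is
    that [|zhat| <= N w] on [[0, L]] implies [|zhat| <= 2/5 N w]
    ([coef_contraction]), and iteration gives [zhat = 0]. *)

(** * Finite and unordered sums *)

HB.instance Definition _ (V : AbelianMonoid) :=
  Monoid.isComLaw.Build V zero plus
    (@plus_assoc V) (@plus_comm V) (@plus_zero_l V).

Section FiniteSums.
Variable T : eqType.
Implicit Types (l : seq T) (B : T -> R).

Lemma rsum_ge0 B l : (forall n, 0 <= B n) -> 0 <= \big[Rplus/0]_(n <- l) B n.
Proof.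
move=> B0; elim/big_rec: _ => [|n x _ hx]; first lra.
by have := B0 n; lra.
Qed.

Lemma rsum_le B B' l : (forall n, B n <= B' n) ->
  \big[Rplus/0]_(n <- l) B n <= \big[Rplus/0]_(n <- l) B' n.
Proof.
move=> BB'; elim/big_rec2: _ => [|n x y _ h]; first lra.
by have := BB' n; lra.
Qed.

Lemma rsum_mulr k B l :
  \big[Rplus/0]_(n <- l) (k * B n) = k * \big[Rplus/0]_(n <- l) B n.
Proof.
elim: l => [|a l IH]; first by rewrite !big_nil; lra.
by rewrite !big_cons IH; lra.
Qed.

Lemma uniq_split l0 l : uniq l0 -> uniq l -> {subset l0 <= l} ->
  perm_eq l (l0 ++ filter (predC (mem l0)) l).
Proof.
move=> u0 ul sub; apply: uniq_perm => //.
  rewrite cat_uniq u0 filter_uniq // andbT /=.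
  by apply/hasPn => x; rewrite mem_filter => /andP[].
move=> x; rewrite mem_cat mem_filter /=.
by case: (boolP (x \in l0)) => [/sub ->|].
Qed.

Lemma rsum_subset B l l' : (forall n, 0 <= B n) -> uniq l -> uniq l' ->
  {subset l <= l'} ->
  \big[Rplus/0]_(n <- l) B n <= \big[Rplus/0]_(n <- l') B n.
Proof.
move=> B0 ul ul' sub; rewrite (perm_big _ (uniq_split ul ul' sub)) big_cat /=.
by have := rsum_ge0 (filter (predC (mem l)) l') B0; lra.
Qed.

End FiniteSums.

(** The partial sums of [is_usum], named: a bare big operator over a normed
    module occurs with several convertible carriers, and real arithmetic would
    take two such forms of one norm for different atoms. *)
Definition psum (T : eqType) (V : NormedModule R_AbsRing) (f : T -> V)
    (l : seq T) : V :=
  \big[plus/zero]_(n <- l) f n.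

Section PartialSums.
Variables (T : eqType) (V : NormedModule R_AbsRing).
Implicit Types (f g : T -> V) (l : seq T).

Lemma psum_nil f : psum f nil = zero. Proof. exact: big_nil. Qed.

Lemma psum_cons f a l : psum f (a :: l) = plus (f a) (psum f l).
Proof. exact: big_cons. Qed.

Lemma psum_cat f l l' : psum f (l ++ l') = plus (psum f l) (psum f l').
Proof. exact: big_cat. Qed.

Lemma psum_perm f l l' : perm_eq l l' -> psum f l = psum f l'.
Proof. exact: perm_big. Qed.

Lemma eq_psum f g l : {in l, f =1 g} -> psum f l = psum g l.
Proof. by move=> fg; apply: eq_big_seq. Qed.

Lemma psum0 f l : {in l, forall n, f n = zero} -> psum f l = zero.
Proof.
move=> f0; rewrite (@eq_psum _ (fun _ => zero) l) //.
by elim: l {f0} => [|a l IH]; rewrite ?psum_nil // psum_cons IH plus_zero_l.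
Qed.

Lemma psum_plus f g l :
  psum (fun n => plus (f n) (g n)) l = plus (psum f l) (psum g l).
Proof. exact: big_split. Qed.

Lemma psum_filter (p : pred T) f l : {in l, forall n, ~~ p n -> f n = zero} ->
  psum f l = psum f (filter p l).
Proof.
elim: l => //= a l IH f0; have {}IH := IH (fun n nl => f0 n (@mem_behead _ (a :: l) n nl)).
rewrite psum_cons IH; case: ifP => [_|/negbT pa]; first by rewrite psum_cons.
by rewrite f0 ?mem_head ?plus_zero_l.
Qed.

Lemma norm_psum_in f (B : T -> R) l : {in l, forall n, norm (f n) <= B n} ->
  norm (psum f l) <= \big[Rplus/0]_(n <- l) B n.
Proof.
elim: l => [|a l IH] fB; first by rewrite psum_nil big_nil norm_zero; lra.
rewrite psum_cons big_cons; apply: (Rle_trans _ _ _ (norm_triangle _ _)).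
have := fB a (mem_head _ _); have := IH (fun n nl => fB n (@mem_behead _ (a :: l) n nl)).
by move=> *; lra.
Qed.

Lemma norm_psum f (B : T -> R) l : (forall n, norm (f n) <= B n) ->
  norm (psum f l) <= \big[Rplus/0]_(n <- l) B n.
Proof. by move=> fB; apply: norm_psum_in. Qed.

End PartialSums.

Lemma psum_map (S T : eqType) (V : NormedModule R_AbsRing) (phi : S -> T)
    (f : T -> V) l :
  psum f (map phi l) = psum (fun a => f (phi a)) l.
Proof. exact: big_map. Qed.

Lemma psum_morph (T : eqType) (V W : NormedModule R_AbsRing) (h : V -> W)
    (f : T -> V) l :
  h zero = zero -> (forall x y, h (plus x y) = plus (h x) (h y)) ->
  psum (fun n => h (f n)) l = h (psum f l).
Proof.
by move=> h0 hD; elim: l => [|a l IH]; rewrite ?psum_nil // !psum_cons hD IH.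
Qed.

(** Bounded partial sums rather than an existing sum, so that passing to a
    dominated family or to a subfamily costs nothing. *)
Definition summable (T : eqType) (B : T -> R) : Prop :=
  (forall n, 0 <= B n) /\
  exists S, forall l, uniq l -> \big[Rplus/0]_(n <- l) B n <= S.

Section Summable.
Variable T : eqType.
Implicit Types (l : seq T) (B : T -> R).

Lemma summable_le B B' : (forall n, 0 <= B n <= B' n) -> summable B' ->
  summable B.
Proof.
move=> h [B'0 [S hS]]; split; first by move=> n; case: (h n).
exists S => l ul; apply: Rle_trans (hS _ ul).
by apply: rsum_le => n; case: (h n).
Qed.

Lemma summable_mulr k B : 0 <= k -> summable B -> summable (fun n => k * B n).
Proof.
move=> k0 [B0 [S hS]]; split; first by move=> n; exact: Rmult_le_pos.
exists (k * S) => l ul; rewrite rsum_mulr.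
by apply: Rmult_le_compat_l => //; apply: hS.
Qed.

(** A list whose sum is within [eps] of the supremum of all partial sums leaves
    at most [eps] outside itself. *)
Lemma summable_tail B : summable B -> forall eps, 0 < eps ->
  exists l0, uniq l0 /\ forall l, uniq l -> {in l, forall n, n \notin l0} ->
    \big[Rplus/0]_(n <- l) B n <= eps.
Proof.
move=> [B0 [S hS]] eps e0.
pose E x := exists2 l, uniq l & x = \big[Rplus/0]_(n <- l) B n.
have [|| s [ub lb]] := completeness E.
- by exists S => x [l ul ->]; apply: hS.
- by exists 0, nil; rewrite ?big_nil.
have [l0 u0 hl0] : exists2 l0, uniq l0 & s - eps < \big[Rplus/0]_(n <- l0) B n.
  apply: Classical_Prop.NNPP => H.
  have : s <= s - eps.
    apply: lb => x [l ul ->]; apply: Rnot_lt_le => h; apply: H.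
    by exists l.
  lra.
exists l0; split=> // l ul dis.
have : \big[Rplus/0]_(n <- l0 ++ l) B n <= s.
  apply: ub; exists (l0 ++ l) => //.
  rewrite cat_uniq u0 ul andbT; apply/hasPn => x xl; exact: dis.
by rewrite big_cat /=; lra.
Qed.

End Summable.

Lemma nbhs_filter (x : R) : Filter (locally (x : R_UniformSpace)).
Proof. exact: (@filter_filter _ _ (locally_filter (x : R_UniformSpace))). Qed.

(** Presents [is_usum] as a limit along a filter, which gives uniqueness,
    additivity and completeness from the general theory of limits. *)
Definition usum_filter (T : eqType) (P : seq T -> Prop) : Prop :=
  exists l0 : seq T, forall l, uniq l -> {subset l0 <= l} -> P l.

#[local] Instance usum_filter_proper (T : eqType) : ProperFilter (@usum_filter T).
Proof.
split.
  move=> P [l0 h]; exists (undup l0); apply: h; first exact: undup_uniq.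
  by move=> x; rewrite mem_undup.
split; first by exists nil.
  move=> P Q [l0 h0] [l1 h1]; exists (l0 ++ l1) => l ul sub; split.
    by apply: h0 => // x xl; apply: sub; rewrite mem_cat xl.
  by apply: h1 => // x xl; apply: sub; rewrite mem_cat xl orbT.
by move=> P Q PQ [l0 h]; exists l0 => l ul sub; apply/PQ/h.
Qed.

Lemma minus_triangle (V : NormedModule R_AbsRing) (a b c : V) :
  norm (minus a c) <= norm (minus a b) + norm (minus b c).
Proof. by rewrite (minus_trans b a c); exact: norm_triangle. Qed.

Lemma norm_minusC (V : NormedModule R_AbsRing) (a b : V) :
  norm (minus a b) = norm (minus b a).
Proof. by rewrite -norm_opp opp_minus. Qed.

Section UnorderedSums.
Variables (T : eqType) (V : NormedModule R_AbsRing).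
Implicit Types (l : seq T) (B : T -> R) (f g : T -> V) (s : V).

Lemma is_usumI f s :
  (forall eps : posreal, exists l0 : seq T, forall l, uniq l ->
    {subset l0 <= l} -> norm (minus (psum f l) s) < eps) -> is_usum f s.
Proof. by []. Qed.

Lemma is_usum_filterlim f s : is_usum f s <->
  filterlim (fun l => psum f l) (@usum_filter T)
    (locally s).
Proof.
split=> [h|/filterlim_locally_ball_norm h eps].
  by apply/filterlim_locally_ball_norm => eps; case: (h eps) => l0 hl; exists l0.
by case: (h eps) => l0 hl; exists l0.
Qed.

Lemma is_usum_unique f s s' : is_usum f s -> is_usum f s' -> s = s'.
Proof.
move=> /is_usum_filterlim h /is_usum_filterlim h'.
exact: (@filterlim_locally_unique _ _ _ _
  (Proper_StrongProper _ (usum_filter_proper T)) _ _ _ h h').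
Qed.

Lemma is_usum_ext f g s : (forall n, f n = g n) -> is_usum f s -> is_usum g s.
Proof.
move=> fg h; refine (is_usumI _) => eps; have [l0 hl] := h eps; exists l0 => l ul sub.
by rewrite -(@eq_psum _ _ f) //; apply: hl.
Qed.

Lemma is_usum_plus f g s s' : is_usum f s -> is_usum g s' ->
  is_usum (fun n => plus (f n) (g n)) (plus s s').
Proof.
move=> /is_usum_filterlim h /is_usum_filterlim h'; apply/is_usum_filterlim.
apply: (filterlim_ext (fun l =>
  plus (psum f l) (psum g l))).
  by move=> l; rewrite -psum_plus.
by apply: filterlim_comp_2 h h' _; exact: filterlim_plus.
Qed.

Lemma is_usum0 : is_usum (fun _ : T => zero : V) zero.
Proof.
refine (is_usumI _) => eps; exists nil => l _ _.
rewrite psum0 // minus_eq_zero norm_zero; exact: cond_pos.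
Qed.

(** A partial sum over a list containing [l0] differs from the one over [l0] by
    a piece of the tail; then let it tend to [s]. *)
Lemma is_usum_tail f B s l0 eps : is_usum f s ->
  (forall n, norm (f n) <= B n) -> uniq l0 ->
  (forall l, uniq l -> {in l, forall n, n \notin l0} ->
    \big[Rplus/0]_(n <- l) B n <= eps) ->
  norm (minus (psum f l0) s) <= eps.
Proof.
move=> hs fB u0 tail; apply: le_epsilon => d d0.
have [l1 h1] := hs (mkposreal d d0).
pose l2 := filter (predC (mem l0)) (undup l1).
have u2 : uniq l2 by rewrite filter_uniq ?undup_uniq.
have d2 : {in l2, forall n, n \notin l0}.
  by move=> n; rewrite mem_filter => /andP[].
have := h1 (l0 ++ l2); rewrite cat_uniq u0 u2 andbT /= => /(_ _ _) h.
have {}h := h _ _.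
have {h}: norm (minus (psum f (l0 ++ l2)) s) < d.
  apply: h; first by apply/hasPn => x /d2.
  move=> x xl; rewrite mem_cat mem_filter mem_undup xl /= andbT.
  by case: (x \in l0).
rewrite psum_cat => h.
have := minus_triangle (psum f l0)
  (plus (psum f l0) (psum f l2)) s.
have -> : norm (minus (psum f l0)
  (plus (psum f l0) (psum f l2)))
  = norm (psum f l2).
  rewrite norm_minusC /minus plus_comm plus_assoc.
  by rewrite (plus_comm (opp _)) plus_opp_r plus_zero_l.
have := norm_psum l2 fB; have := tail l2 u2 d2; move=> *; lra.
Qed.

Lemma is_usum_norm_le f B s S : is_usum f s -> (forall n, norm (f n) <= B n) ->
  (forall l, uniq l -> \big[Rplus/0]_(n <- l) B n <= S) -> norm s <= S.
Proof.
move=> hs fB hS; have := is_usum_tail (l0 := nil) hs fB isT (fun l ul _ => hS l ul).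
by rewrite psum_nil /minus plus_zero_l norm_opp.
Qed.

Lemma is_usum_finite f l0 : uniq l0 -> (forall n, n \notin l0 -> f n = zero) ->
  is_usum f (psum f l0).
Proof.
move=> u0 f0; refine (is_usumI _) => eps; exists l0 => l ul sub.
rewrite (psum_perm _ (uniq_split u0 ul sub)) psum_cat.
rewrite [X in plus _ X]psum0; last by move=> x; rewrite mem_filter => /andP[/f0].
rewrite plus_zero_r minus_eq_zero norm_zero; exact: cond_pos.
Qed.

End UnorderedSums.

Lemma is_usum_map (T : eqType) (V W : NormedModule R_AbsRing) (h : V -> W)
    (f : T -> V) s (k : R) :
  (forall x y, h (plus x y) = plus (h x) (h y)) ->
  (forall x, norm (h x) <= k * norm x) ->
  is_usum f s -> is_usum (fun n => h (f n)) (h s).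
Proof.
move=> hD hk hs.
have h0 : h zero = zero.
  by apply: (@plus_reg_l _ (h zero)); rewrite -hD !plus_zero_r.
have hB x y : h (minus x y) = minus (h x) (h y).
  apply: (@plus_reg_r _ (h y)); rewrite -hD /minus -!plus_assoc.
  by rewrite !plus_opp_l !plus_zero_r.
refine (is_usumI _) => eps; pose k' := Rmax k 1.
have k1 : 0 < k' by have := Rmax_r k 1; rewrite /k'; lra.
have ek : 0 < eps / k' by apply: Rdiv_lt_0_compat => //; exact: cond_pos.
have [l0 hl] := hs (mkposreal _ ek); exists l0 => l ul sub.
rewrite psum_morph // -hB; apply: (Rle_lt_trans _ _ _ (hk _)).
have /= := hl l ul sub; set x := norm _ => xe.
apply: (Rle_lt_trans _ (k' * x)).
  by apply: Rmult_le_compat_r; [exact: norm_ge_0|exact: Rmax_l].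
have -> : pos eps = k' * (eps / k') by field; lra.
exact: Rmult_lt_compat_l.
Qed.

Lemma ex_usum (T : eqType) (V : CompleteNormedModule R_AbsRing) (f : T -> V) B :
  summable B -> (forall n, norm (f n) <= B n) -> exists s : V, is_usum f s.
Proof.
move=> sB fB.
have [H _] := filterlim_locally_cauchy (F := @usum_filter T)
  (fun l => psum f l : V).
have [|s hs] := H; last by exists s; apply/is_usum_filterlim.
move=> eps; have e2 : 0 < eps / 3 by have := cond_pos eps; lra.
have [l0 [u0 tail]] := summable_tail sB e2.
exists (fun l => uniq l /\ {subset l0 <= l}); split; first by exists l0.
have main l : uniq l -> {subset l0 <= l} ->
    norm (minus (psum f l : V)
      (psum f l0 : V)) <= eps / 3.
  move=> ul sub; rewrite (psum_perm _ (uniq_split u0 ul sub)) psum_cat.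
  rewrite /minus plus_comm plus_assoc plus_opp_l plus_zero_l.
  apply: (Rle_trans _ _ _ (norm_psum _ fB)); apply: tail.
    exact: filter_uniq.
  by move=> x; rewrite mem_filter => /andP[].
move=> l l' [ul sl] [ul' sl']; apply: norm_compat1.
apply: (Rle_lt_trans _ _ _ (minus_triangle _ (psum f l0) _)).
rewrite (norm_minusC (psum f l0)).
apply: (Rle_lt_trans _ (eps / 3 + eps / 3)); last by have := cond_pos eps; lra.
exact: Rplus_le_compat (main _ ul' sl') (main _ ul sl).
Qed.

Lemma usumP (T : eqType) (V : CompleteNormedModule R_AbsRing) (f : T -> V) s :
  is_usum f s -> usum f = s.
Proof. by move=> h; apply: iota_unique => // y hy; apply: is_usum_unique hy h. Qed.

Lemma is_usum_usum (T : eqType) (V : CompleteNormedModule R_AbsRing)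
    (f : T -> V) B : summable B -> (forall n, norm (f n) <= B n) ->
  is_usum f (usum f).
Proof. by move=> sB fB; have [s hs] := ex_usum sB fB; rewrite (usumP hs). Qed.

Lemma is_usum_psum (S T : eqType) (V : NormedModule R_AbsRing)
    (F : S -> T -> V) (s : S -> V) l :
  (forall i, i \in l -> is_usum (F i) (s i)) ->
  is_usum (fun t => psum (F^~ t) l) (psum s l).
Proof.
elim: l => [|a l IH] h.
  rewrite psum_nil; apply: is_usum_ext (is_usum0 _ _) => t.
  by rewrite psum_nil.
have h2 := IH (fun i il => h i (@mem_behead _ (a :: l) i il)).
rewrite psum_cons; apply: is_usum_ext (is_usum_plus (h a (mem_head _ _)) h2) => t.
by rewrite psum_cons.
Qed.

Section Rearrangement.
Variables (S T : eqType) (V : NormedModule R_AbsRing).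

(** The inverse [psi] is given as a total function so that membership in the
    image of [phi] is decidable.  Translations of the lattice, shifts of the
    degree and slices of a product are all of this form. *)
Lemma is_usum_reindex (phi : S -> T) (psi : T -> S) (f : T -> V) s :
  cancel phi psi -> (forall t, phi (psi t) != t -> f t = zero) ->
  is_usum (fun a => f (phi a)) s -> is_usum f s.
Proof.
move=> phiK f0 hs; refine (is_usumI _) => eps; have [l0 hl0] := hs eps.
exists (map phi l0) => l ul sub.
pose l1 := filter (fun t => phi (psi t) == t) l.
have -> : psum f l = psum (fun a => f (phi a)) (map psi l1).
  rewrite psum_map (psum_filter (p := fun t => phi (psi t) == t)).
    by apply: eq_psum => t; rewrite mem_filter => /andP[/eqP ->].
  by move=> t _ /f0.
apply: hl0.
  rewrite map_inj_in_uniq ?filter_uniq // => x y; rewrite !mem_filter.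
  by move=> /andP[/eqP hx _] /andP[/eqP hy _] xy; rewrite -hx -hy xy.
move=> a al; apply/mapP; exists (phi a); last by rewrite phiK.
by rewrite mem_filter phiK eqxx /=; apply/sub/map_f.
Qed.

(** Summation by packets.  A projection [pi] gives Fubini's theorem, and an
    addition [pi] gives the product of two series as a series of convolutions.
    A sum of [g] over a finite set of packets is the sum of a family that is
    still dominated by [B], hence is determined up to the tail by [l0]. *)
Lemma is_usum_regroup (pi : S -> T) (f : S -> V) (B : S -> R) (g : T -> V) s :
  summable B -> (forall a, norm (f a) <= B a) -> is_usum f s ->
  (forall t, is_usum (fun a => if pi a == t then f a else zero) (g t)) ->
  is_usum g s.
Proof.
move=> sB fB hs hg; refine (is_usumI _) => eps.
have e3 : 0 < eps / 3 by have := cond_pos eps; lra.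
have [l0 [u0 tail]] := summable_tail sB e3.
exists (map pi l0) => l ul sub.
have B0 a : 0 <= B a by case: sB.
have hl : is_usum (fun a => if pi a \in l then f a else zero)
    (psum g l).
  elim: l ul {sub} => [|t l IH] /=.
    by move=> _; rewrite psum_nil; apply: is_usum_ext (is_usum0 _ _).
  case/andP=> tl ul; rewrite psum_cons.
  apply: is_usum_ext (is_usum_plus (hg t) (IH ul)) => a.
  rewrite in_cons; case: eqP => [->|_] /=; last by rewrite plus_zero_l.
  by rewrite (negbTE tl) plus_zero_r.
have /(_ _)h1 := is_usum_tail hl (B := B) _ u0 tail.
have h2 := is_usum_tail hs fB u0 tail.
have e : psum (fun a => if pi a \in l then f a else zero) l0
    = psum f l0.
  by apply: eq_psum => a al; rewrite sub // map_f.
apply: (Rle_lt_trans _ _ _ (minus_triangle _ (psum f l0) _)).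
rewrite (norm_minusC (psum g l)) -{1}e.
have := h1 _; have := cond_pos eps; move=> e0 {}h1.
suff: norm (minus
   (psum (fun a => if pi a \in l then f a else zero) l0)
   (psum g l)) <= eps / 3 by move: h2; move=> *; lra.
by apply: h1 => a; case: ifP => // _; rewrite norm_zero.
Qed.

End Rearrangement.

Lemma is_usum_opp (T : eqType) (V : NormedModule R_AbsRing) (f : T -> V) s :
  is_usum f s -> is_usum (fun n => opp (f n)) (opp s).
Proof.
apply: (is_usum_map (h := opp) (k := 1)); first by move=> x y; exact: opp_plus.
by move=> x; rewrite norm_opp; lra.
Qed.

Lemma is_usum_minus (T : eqType) (V : NormedModule R_AbsRing) (f g : T -> V)
    s s' : is_usum f s -> is_usum g s' ->
  is_usum (fun n => minus (f n) (g n)) (minus s s').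
Proof. by move=> hf /is_usum_opp; apply: is_usum_plus. Qed.

Lemma is_usum_scal (T : eqType) (V : NormedModule R_AbsRing) (f : T -> V) s
    (k : R) :
  is_usum f s -> is_usum (fun n => scal k (f n)) (scal k s).
Proof.
apply: (is_usum_map (h := scal k) (k := Rabs k)).
  by move=> x y; exact: scal_distr_l.
by move=> x; exact: norm_scal.
Qed.

Lemma summable_rsum_le (T : eqType) (B : T -> R) (s : R) l :
  (forall n, 0 <= B n) -> is_usum (V := R_NormedModule) B s -> uniq l ->
  \big[Rplus/0]_(n <- l) B n <= s.
Proof.
move=> B0 hs ul; apply: le_epsilon => e e0.
have [l0 h] := hs (mkposreal e e0).
have {h} := h (undup (l ++ l0)) (undup_uniq _).
have sub : {subset l <= undup (l ++ l0)}.
  by move=> x xl; rewrite mem_undup mem_cat xl.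
have le := rsum_subset B0 ul (undup_uniq _) sub.
move=> h; have {h}/Rabs_lt_between : norm
    (minus (\big[Rplus/0]_(n <- undup (l ++ l0)) B n : R_NormedModule) s) < e.
  by apply: h => x xl; rewrite mem_undup mem_cat xl orbT.
by rewrite /minus /plus /opp /=; lra.
Qed.

(** A finite set of pairs lies in the rectangle spanned by its projections. *)
Lemma summable_prod (T1 T2 : eqType) (B1 : T1 -> R) (B2 : T2 -> R) :
  summable B1 -> summable B2 -> summable (fun p => B1 p.1 * B2 p.2).
Proof.
move=> [B10 [S1 h1]] [B20 [S2 h2]]; split=> [p|]; first exact: Rmult_le_pos.
exists (S1 * S2) => l ul.
pose l1 := undup (map fst l); pose l2 := undup (map snd l).
pose L := [seq (a, b) | a <- l1, b <- l2].
have uL : uniq L.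
  by apply: allpairs_uniq; rewrite ?undup_uniq // => -[a b] [c d] _ _ [-> ->].
apply: (Rle_trans _ (\big[Rplus/0]_(p <- L) (B1 p.1 * B2 p.2))).
  apply: rsum_subset => // [p|[a b] pl]; first exact: Rmult_le_pos.
  by apply/allpairsP; exists (a, b); rewrite !mem_undup; split=> //;
    apply/mapP; exists (a, b).
rewrite big_allpairs_dep /=.
under eq_bigr do rewrite rsum_mulr Rmult_comm.
rewrite rsum_mulr Rmult_comm.
apply: Rmult_le_compat; try exact: rsum_ge0.
  by apply: h1; exact: undup_uniq.
by apply: h2; exact: undup_uniq.
Qed.

Section Limits.
Variables (T : eqType) (V : NormedModule R_AbsRing).

(** Dominated convergence, along an arbitrary filter. *)
Lemma filterlim_usum (X : Type) (F : (X -> Prop) -> Prop) (f : T -> X -> V)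
    (a : T -> V) (B : T -> R) (G : X -> V) (s : V) :
  Filter F -> summable B ->
  (forall n, filterlim (f n) F (locally (a n))) ->
  F (fun p => (forall n, norm (f n p) <= B n) /\ is_usum (fun n => f n p) (G p)) ->
  (forall n, norm (a n) <= B n) -> is_usum a s ->
  filterlim G F (locally s).
Proof.
move=> FF sB lim ev aB hs; apply/filterlim_locally_ball_norm => eps.
have e4 : 0 < eps / 4 by have := cond_pos eps; lra.
have [l0 [u0 tail]] := summable_tail sB e4.
have fin : F (fun p => norm (minus (psum (fun n => f n p) l0) (psum a l0))
    < eps / 4).
  have L : filterlim (fun p => psum (fun n => f n p) l0) F
      (locally (psum a l0)).
    elim: (l0) => [|n l IH].
      apply: (filterlim_ext (fun _ => zero)) => [p|]; first by rewrite psum_nil.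
      by rewrite psum_nil; exact: filterlim_const.
    apply: (filterlim_ext (fun p => plus (f n p) (psum (fun n => f n p) l))).
      by move=> p; rewrite psum_cons.
    rewrite psum_cons.
    by apply: filterlim_comp_2 (lim n) IH _; exact: filterlim_plus.
  by move/filterlim_locally_ball_norm: L => /(_ (mkposreal _ e4)).
have H := @filter_and _ F FF _ _ ev fin.
apply: filter_imp H => p [[fB hp] hfin].
have h1 := is_usum_tail hp fB u0 tail.
have h2 := is_usum_tail hs aB u0 tail.
apply: (Rle_lt_trans _ _ _
  (minus_triangle _ (psum (fun n => f n p) l0) _)).
rewrite (norm_minusC (G p)).
have := minus_triangle (psum (fun n => f n p) l0) (psum a l0) s.
have := cond_pos eps.
by move: h1 h2 hfin; rewrite /psum => *; lra.
Qed.

(** Term-by-term differentiation: the head of the sum is a finite sum of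
    differentiable functions, and the difference quotients of the tail are
    bounded by the tail of the Lipschitz constants [B].  Lipschitz constants are
    the right data here: a second-order remainder estimate would cost one more
    power of the frequency than the decay affords. *)
Lemma is_derive_usum (f : T -> R -> V) (f' : T -> V) (B : T -> R) (G : R -> V)
    (s : V) (x d : R) :
  summable B -> 0 < d ->
  (forall y, Rabs (y - x) < d -> is_usum (fun n => f n y) (G y)) ->
  (forall n, is_derive (f n) x (f' n)) ->
  (forall n y, Rabs (y - x) < d ->
    norm (minus (f n y) (f n x)) <= B n * Rabs (y - x)) ->
  (forall n, norm (f' n) <= B n) ->
  is_usum f' s -> is_derive G x s.
Proof.
move=> sB d0 hG df lip f'B hs; split; first exact: is_linear_scal_l.
move=> _ /(is_filter_lim_locally_unique x) <- eps.
pose D n y := minus (minus (f n y) (f n x)) (scal (minus y x) (f' n)).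
have e8 : 0 < eps / 4 by have := cond_pos eps; lra.
have [l0 [u0 tail]] := summable_tail sB e8.
have FF := nbhs_filter x.
have fin (l : seq T) (e : posreal) : locally x (fun y =>
    norm (psum (fun n => D n y) l) <= e * norm (minus y x)).
  elim: l e => [|n l IH] e.
    apply: filter_forall => y; rewrite psum_nil norm_zero.
    by apply: Rmult_le_pos; [have := cond_pos e; lra|exact: norm_ge_0].
  have [_ dn] := df n.
  have {}dn := dn x (fun P h => h) (pos_div_2 e).
  have H := @filter_and _ _ FF _ _ dn (IH (pos_div_2 e)).
  apply: filter_imp H => y /= [h1 h2]; rewrite psum_cons.
  apply: (Rle_trans _ _ _ (norm_triangle _ _)).
  have -> : e * norm (minus y x)
    = e / 2 * norm (minus y x) + e / 2 * norm (minus y x) by field.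
  exact: Rplus_le_compat.
have near : locally x (fun y => Rabs (y - x) < d) by exists (mkposreal d d0).
have H := @filter_and _ _ FF _ _ near (fin l0 (pos_div_2 eps)).
apply: filter_imp H => y [yd hfin].
set N := norm (minus y x) in hfin *.
have NE : N = Rabs (y - x) by [].
have N0 : 0 <= N by exact: norm_ge_0.
have hD : is_usum (fun n => D n y)
    (minus (minus (G y) (G x)) (scal (minus y x) s)).
  apply: is_usum_minus; last exact: is_usum_scal.
  apply: is_usum_minus; first exact: hG.
  by apply: hG; rewrite Rminus_diag Rabs_R0.
have DB n : norm (D n y) <= (2 * N) * B n.
  rewrite /D {1}/minus; apply: (Rle_trans _ _ _ (norm_triangle _ _)).
  rewrite norm_opp.
  have h1 := lip n y yd; rewrite -NE in h1.
  have h2 : norm (scal (minus y x) (f' n)) <= N * B n.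
    apply: (Rle_trans _ _ _ (norm_scal _ _)).
    by apply: Rmult_le_compat_l => //; exact: f'B.
  apply: (Rle_trans _ (B n * N + N * B n)); first exact: Rplus_le_compat.
  lra.
have tail2 l : uniq l -> {in l, forall n, n \notin l0} ->
    \big[Rplus/0]_(n <- l) (2 * N * B n) <= eps / 2 * N.
  move=> ul dl; rewrite rsum_mulr; have h := tail l ul dl.
  apply: (Rle_trans _ (2 * N * (eps / 4))); last lra.
  by apply: Rmult_le_compat_l => //; lra.
have h := is_usum_tail hD DB u0 tail2.
set z := minus (minus (G y) (G x)) _ in h *.
have -> : norm z = norm (minus z zero) by rewrite /minus opp_zero plus_zero_r.
apply: (Rle_trans _ _ _ (minus_triangle _ (psum (fun n => D n y) l0) _)).
rewrite norm_minusC {2}/minus opp_zero plus_zero_r.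
have -> : eps * N = eps / 2 * N + eps / 2 * N by field.
exact: Rplus_le_compat h hfin.
Qed.

End Limits.

Lemma normC (z : C) : norm (z : C_R_NormedModule) = Cmod z.
Proof. by rewrite Cmod_norm. Qed.

Lemma is_usum_Cmult (T : eqType) (f : T -> C) (s a : C) :
  is_usum (V := C_R_NormedModule) f s ->
  is_usum (V := C_R_NormedModule) (fun n => Cmult a (f n)) (Cmult a s).
Proof.
apply: (is_usum_map (V := C_R_NormedModule) (W := C_R_NormedModule)
  (h := Cmult a) (k := Cmod a)).
  by move=> x y; exact: Cmult_plus_distr_l.
by move=> x; rewrite !normC Cmod_mult; lra.
Qed.

(** Summing the double family along its rows identifies its total. *)
Lemma is_usum_mult (T1 T2 : eqType) (f : T1 -> C) (g : T2 -> C)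
    (B1 : T1 -> R) (B2 : T2 -> R) (s1 s2 : C) :
  summable B1 -> summable B2 ->
  (forall n, Cmod (f n) <= B1 n) -> (forall n, Cmod (g n) <= B2 n) ->
  is_usum (V := C_R_NormedModule) f s1 ->
  is_usum (V := C_R_NormedModule) g s2 ->
  is_usum (V := C_R_NormedModule) (fun p => Cmult (f p.1) (g p.2))
    (Cmult s1 s2).
Proof.
move=> sB1 sB2 fB gB h1 h2.
have sB := summable_prod sB1 sB2.
pose F (p : T1 * T2) : C_R_NormedModule := Cmult (f p.1) (g p.2).
have FB (p : T1 * T2) : norm (F p) <= B1 p.1 * B2 p.2.
  rewrite normC Cmod_mult.
  by apply: Rmult_le_compat => //; exact: Cmod_ge_0.
have [s hs] := ex_usum (V := C_R_CompleteNormedModule) (f := F) sB FB.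
suff -> : Cmult s1 s2 = s by [].
have hrow a : is_usum (V := C_R_NormedModule)
    (fun p : T1 * T2 => if p.1 == a then F p else zero) (Cmult (f a) s2).
  apply: (is_usum_reindex (phi := fun b => (a, b)) (psi := snd)) => //=.
    by move=> [a' b] /=; case: (eqVneq a' a) => // ->; rewrite eqxx.
  apply: (is_usum_ext _ (is_usum_Cmult (f a) h2)) => b /=.
  by rewrite eqxx.
have h := is_usum_regroup sB FB hs hrow.
rewrite Cmult_comm; apply: (is_usum_unique _ h).
apply: (is_usum_ext _ (is_usum_Cmult s2 h1)) => a; exact: Cmult_comm.
Qed.

(** * Criteria for summability *)

Lemma summable_inj (S T : eqType) (phi : S -> T) (B : T -> R) :
  injective phi -> summable B -> summable (fun a => B (phi a)).
Proof.
move=> inj [B0 [C hC]]; split=> // ; exists C => l ul.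
by rewrite -(big_map phi xpredT); apply: hC; rewrite map_inj_uniq.
Qed.

Lemma summable_fin (T : finType) (B : T -> R) :
  (forall n, 0 <= B n) -> summable B.
Proof.
move=> B0; split=> //; exists (\big[Rplus/0]_(n <- enum T) B n) => l ul.
by apply: rsum_subset => //; [exact: enum_uniq|move=> x; rewrite mem_enum].
Qed.

Lemma summable_nat (h : nat -> R) (S : R) : (forall k, 0 <= h k) ->
  (forall N, \big[Rplus/0]_(k <- seq.iota 0 N) h k <= S) -> summable h.
Proof.
move=> h0 hS; split=> //; exists S => l ul.
apply: Rle_trans (hS (\max_(k <- l) k).+1).
apply: rsum_subset => //; first exact: iota_uniq.
move=> k kl; rewrite mem_iota /= add0n ltnS.
exact: leq_bigmax_seq.
Qed.

Lemma rsum_iotaS (h : nat -> R) N :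
  \big[Rplus/0]_(k <- seq.iota 0 N.+1) h k
  = \big[Rplus/0]_(k <- seq.iota 0 N) h k + h N.
Proof. by rewrite -addn1 iotaD big_cat /= big_seq1 add0n. Qed.

Lemma geometric_rsum_le x N : 0 <= x < 1 ->
  \big[Rplus/0]_(k <- seq.iota 0 N) pow x k <= / (1 - x).
Proof.
move=> x01; have -> : \big[Rplus/0]_(k <- seq.iota 0 N) pow x k
  = (1 - pow x N) * / (1 - x).
  elim: N => [|N IH]; first by rewrite big_nil /=; lra.
  by rewrite rsum_iotaS IH /=; field; lra.
have : 0 < / (1 - x) by apply: Rinv_0_lt_compat; lra.
have : 0 <= pow x N by apply: pow_le; lra.
by nra.
Qed.

Lemma summable_geometric x : 0 <= x < 1 -> summable (fun k => pow x k).
Proof.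
move=> x01; apply: (@summable_nat _ (/ (1 - x))) => [k|N].
  by apply: pow_le; lra.
exact: geometric_rsum_le.
Qed.

Lemma ln_succ_ge x : 0 < x -> / (x + 1) <= ln (x + 1) - ln x.
Proof.
move=> x0; have y0 : 0 < x / (x + 1) by apply: Rdiv_lt_0_compat; lra.
have := exp_ineq1_le (ln (x / (x + 1))); rewrite exp_ln // ln_div; try lra.
have -> : x / (x + 1) = 1 - / (x + 1) by field; lra.
by lra.
Qed.

(** The discrete form of [(x^-q)' = - q x^-(q+1)], by which the Riemann series
    telescopes. *)
Lemma Rpower_telescope q x : 0 < q -> 0 < x ->
  q * Rpower (x + 1) (- (q + 1)) <= Rpower x (- q) - Rpower (x + 1) (- q).
Proof.
move=> q0 x0; set y := x + 1.
have hp : Rpower y (- (q + 1)) = Rpower y (- q) * / y.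
  rewrite Ropp_plus_distr Rpower_plus; congr (_ * _).
  by rewrite Rpower_Ropp Rpower_1 // /y; lra.
have hx : Rpower x (- q) = Rpower y (- q) * exp (q * (ln y - ln x)).
  by rewrite /Rpower -exp_plus; congr exp; ring.
have := exp_ineq1_le (q * (ln y - ln x)); have := ln_succ_ge x0.
rewrite -/y hx hp => h1 h2.
have P0 : 0 < Rpower y (- q) by exact: exp_pos.
suff : q * / y <= exp (q * (ln y - ln x)) - 1 by nra.
by nra.
Qed.

Lemma summable_riemann p : 1 < p ->
  summable (fun k : nat => Rpower (1 + INR k) (- p)).
Proof.
move=> p1; pose q := p - 1; have q0 : 0 < q by rewrite /q; lra.
apply: (@summable_nat _ (1 + / q)) => [k|N]; first by apply/Rlt_le/exp_pos.
have iq : 0 < / q by apply: Rinv_0_lt_compat.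
case: N => [|N]; first by rewrite big_nil; lra.
suff : \big[Rplus/0]_(k <- seq.iota 0 N.+1) Rpower (1 + INR k) (- p)
    <= 1 + / q * (1 - Rpower (1 + INR N) (- q)).
  by have := exp_pos (- q * ln (1 + INR N)); rewrite -/(Rpower _ _); nra.
elim: N => [|N IH].
  by rewrite rsum_iotaS big_nil /= Rplus_0_r /Rpower ln_1 !Rmult_0_r exp_0; lra.
rewrite rsum_iotaS S_INR.
have x0 : 0 < 1 + INR N by have := pos_INR N; lra.
have := Rpower_telescope q0 x0.
have -> : q + 1 = p by rewrite /q; ring.
have -> : 1 + INR N + 1 = 1 + (INR N + 1) by ring.
move=> h; have h' : Rpower (1 + (INR N + 1)) (- p)
    <= / q * (Rpower (1 + INR N) (- q) - Rpower (1 + (INR N + 1)) (- q)).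
  apply: (Rmult_le_reg_l q) => //; rewrite -Rmult_assoc Rinv_r; lra.
lra.
Qed.

Lemma summable_int (h : nat -> R) : summable h ->
  summable (fun z : int => h (absz z)).
Proof.
move=> sh.
have sb : summable (fun _ : bool => 1) by apply: summable_fin => _; lra.
have := summable_prod sb sh.
move/(summable_inj (phi := fun z : int => ((z < 0)%R, absz z))).
case=> [|h0 [S hS]]; first by move=> [a|a] [b|b] //= [-> ].
split=> [z|]; first by have := h0 z; rewrite /= Rmult_1_l.
exists S => l ul; apply: Rle_trans (hS l ul).
by apply: rsum_le => z /=; lra.
Qed.

(** Induction on the dimension, splitting off the first coordinate. *)
Lemma summable_row (g : int -> R) nu : summable g ->
  summable (fun n : 'rV[int]_nu => \big[Rmult/1]_(j < nu) g (n ord0 j)).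
Proof.
move=> sg; have g0 z : 0 <= g z by case: sg.
have pos nu' (n : 'rV[int]_nu') : 0 <= \big[Rmult/1]_(j < nu') g (n ord0 j).
  by elim/big_rec: _ => [|j x _ hx]; [lra|exact: Rmult_le_pos].
elim: nu => [|nu IH].
  split=> //; exists 1 => -[|n [|m l]] /=; rewrite ?big_nil; first lra.
    by rewrite big_seq1 big_ord0; lra.
  by rewrite (_ : n = m) ?mem_head //; apply/rowP => -[].
have := summable_prod sg IH.
move/(summable_inj (phi := fun n : 'rV[int]_nu.+1 =>
  (n ord0 ord0, (\row_j n ord0 (lift ord0 j))%R : 'rV[int]_nu))).
case=> [|h0 [S hS]].
  move=> n m [e0 /rowP e1]; apply/rowP => j.
  case: (unliftP ord0 j) => [i ->|-> //].
  by have := e1 i; rewrite !mxE.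
split=> //; exists S => l ul; apply: Rle_trans (hS l ul).
apply: rsum_le => n /=; rewrite big_ord_recl; right.
by congr (_ * _); apply: eq_bigr => i _; rewrite mxE.
Qed.

(** * The polynomial weights *)

Section Weights.
Variable nu : nat.
Implicit Types (n m : 'rV[int]_nu) (omega : 'rV[R]_nu).

Lemma l1norm_triangle n m : (l1norm n <= l1norm m + l1norm (n - m)%R)%N.
Proof.
rewrite /l1norm -big_split /=; apply: leq_sum => j _; rewrite !mxE.
by have := leqD_dist (n ord0 j) (m ord0 j) 0%R; rewrite !subr0 addnC.
Qed.

Lemma absz_le_l1norm n j : (absz (n ord0 j) <= l1norm n)%N.
Proof. by rewrite /l1norm (bigD1 j) //= leq_addr. Qed.

Definition bracket n : R := 1 + INR (l1norm n).

Lemma bracket_ge1 n : 1 <= bracket n.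
Proof. by rewrite /bracket; have := pos_INR (l1norm n); lra. Qed.

Lemma weight_gt0 r n : 0 < weight r n.
Proof. exact: exp_pos. Qed.

Lemma weight_ge0 r n : 0 <= weight r n.
Proof. exact/Rlt_le/weight_gt0. Qed.

Lemma weight_le1 r n : 0 <= r -> weight r n <= 1.
Proof.
move=> r0; rewrite -(Rpower_O (bracket n)); last by have := bracket_ge1 n; lra.
apply: Rle_Rpower; last lra.
exact: bracket_ge1.
Qed.

Lemma weight_bracket2 r n :
  weight r n * (bracket n * bracket n) = weight (r - 2) n.
Proof.
have b1 := bracket_ge1 n; rewrite /weight -/(bracket n).
rewrite (_ : - (r - 2) = - r + 2); last ring.
rewrite Rpower_plus; congr (_ * _).
rewrite -[2]/(INR 2) Rpower_pow; last lra.
by rewrite /= Rmult_1_r.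
Qed.

Lemma weight_half r n m : 0 <= r -> bracket n <= 2 * bracket m ->
  weight r m <= Rpower 2 r * weight r n.
Proof.
move=> r0 mn; have b1 := bracket_ge1 m; have b2 := bracket_ge1 n.
rewrite /weight -/(bracket n) -/(bracket m) !Rpower_Ropp.
have -> : Rpower 2 r * / Rpower (bracket n) r = / Rpower (bracket n / 2) r.
  rewrite /Rdiv -Rpower_mult_distr; try lra.
  rewrite Rinv_mult Rmult_comm; congr (_ * _).
  rewrite /Rpower ln_Rinv; last lra.
  by rewrite -exp_Ropp; congr exp; ring.
apply: Rinv_le_contravar; first exact: exp_pos.
by apply: Rle_Rpower_l => //; lra.
Qed.

(** By the triangle inequality one of [m], [n - m] has a bracket at least half
    that of [n], so that its weight is at most [2^r] times the weight of [n]. *)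
Lemma weight_mul_le r n m : 0 <= r ->
  weight r m * weight r (n - m)%R <=
  Rpower 2 r * weight r n * (weight r m + weight r (n - m)%R).
Proof.
move=> r0; have h : bracket n <= bracket m + bracket (n - m)%R - 1.
  rewrite /bracket; have /leP/le_INR := l1norm_triangle n m.
  by rewrite plus_INR; lra.
have wm := weight_ge0 r m; have wn := weight_ge0 r (n - m)%R.
have wn0 := weight_ge0 r n; have p0 : 0 < Rpower 2 r by exact: exp_pos.
have c0 : 0 <= Rpower 2 r * weight r n by nra.
case: (Rle_lt_dec (bracket n) (2 * bracket m)) => [/(weight_half r0) hm|hm].
  by nra.
have /(weight_half r0) hm' : bracket n <= 2 * bracket (n - m)%R by lra.
by nra.
Qed.

(** Each [1 + |n_j|] is at most [1 + |n|], so the weight is at most the product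
    over [j] of the terms [(1 + |n_j|)^(-s/nu)] of a convergent Riemann series. *)
Lemma summable_weight s : (0 < nu)%N -> INR nu < s ->
  summable (fun n => weight s n).
Proof.
move=> nu0 hs; have n0 : 0 < INR nu by apply/lt_0_INR/ltP.
pose p := s / INR nu.
have p1 : 1 < p.
  apply: (Rmult_lt_reg_r (INR nu)) => //.
  by rewrite /p /Rdiv Rmult_assoc Rinv_l; lra.
have h := @summable_row _ nu (summable_int (summable_riemann p1)).
apply: summable_le h => n; split; first exact: weight_ge0.
have b1 := bracket_ge1 n.
rewrite -big_enum /=.
have -> : weight s n = Rpower (bracket n) (- (p * INR (size (enum 'I_nu)))).
  rewrite size_enum_ord /weight -/(bracket n); congr (Rpower _ (- _)).
  by rewrite /p; field; apply: Rgt_not_eq.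
elim: (enum _) => [|j l IH] /=.
  by rewrite big_nil Rmult_0_r Ropp_0 Rpower_O; lra.
rewrite big_cons.
have -> : - (p * INR (size l).+1) = - p + - (p * INR (size l)).
  by rewrite S_INR; ring.
rewrite Rpower_plus; apply: Rmult_le_compat => //; try exact/Rlt_le/exp_pos.
rewrite !Rpower_Ropp; apply: Rinv_le_contravar; first exact: exp_pos.
apply: Rle_Rpower_l; first lra.
split; first by apply: Rplus_lt_le_0_compat; [lra|exact: pos_INR].
by apply/Rplus_le_compat_l/le_INR/leP/absz_le_l1norm.
Qed.

Lemma weight_total r (l : seq 'rV[int]_nu) : (0 < nu)%N -> INR nu < r -> uniq l ->
  \big[Rplus/0]_(n <- l) weight r n <= Hconst r nu.
Proof.
move=> nu0 hr ul; have sw := summable_weight nu0 hr.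
apply: summable_rsum_le => //; first exact: weight_ge0.
apply: (is_usum_usum (V := R_CompleteNormedModule) sw) => n.
rewrite /norm /= /abs /= Rabs_pos_eq; [lra|exact: weight_ge0].
Qed.

Lemma Hconst_ge0 r : (0 < nu)%N -> INR nu < r -> 0 <= Hconst r nu.
Proof. by move=> nu0 hr; have := weight_total nu0 hr (l := nil) isT; rewrite big_nil. Qed.

Lemma Kconst_ge0 r : (0 < nu)%N -> INR nu < r -> 0 <= Kconst r nu.
Proof.
move=> nu0 hr; apply: Rmult_le_pos; last exact: Hconst_ge0.
exact/Rlt_le/exp_pos.
Qed.

(** The inequality that makes the sequences dominated by the weight an algebra.
    The constant is [2^r] from [weight_mul_le] times two copies of the total
    weight, one for each of [m] and [n - m]. *)
Lemma weight_conv_le r n l : (0 < nu)%N -> INR nu < r -> uniq l ->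
  \big[Rplus/0]_(m <- l) (weight r m * weight r (n - m)%R)
    <= Kconst r nu * weight r n.
Proof.
move=> nu0 hr ul; have r0 : 0 <= r by have := pos_INR nu; lra.
apply: (Rle_trans _ (\big[Rplus/0]_(m <- l)
   (Rpower 2 r * weight r n * (weight r m + weight r (n - m)%R)))).
  by apply: rsum_le => m; exact: weight_mul_le.
rewrite rsum_mulr big_split /=.
have h1 := weight_total nu0 hr ul.
have h2 : \big[Rplus/0]_(m <- l) weight r (n - m)%R <= Hconst r nu.
  rewrite -(big_map (fun m => (n - m)%R) xpredT (weight r)).
  apply: weight_total => //; rewrite map_inj_uniq // => x y /addrI.
  exact: oppr_inj.
have c0 : 0 <= Rpower 2 r * weight r n.
  by apply: Rmult_le_pos; [exact/Rlt_le/exp_pos|exact: weight_ge0].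
apply: (Rle_trans _ (Rpower 2 r * weight r n * (2 * Hconst r nu))).
  apply: Rmult_le_compat_l => //.
  rewrite (_ : 2 * _ = Hconst r nu + Hconst r nu); last ring.
  exact: Rplus_le_compat.
by rewrite /Kconst Rpower_plus Rpower_1; lra.
Qed.

Lemma pairingD omega n m :
  pairing (n + m)%R omega = pairing n omega + pairing m omega.
Proof.
rewrite -[RHS]/(pairing n omega + pairing m omega)%R.
rewrite /pairing -big_split /=; apply: eq_bigr => j _.
by rewrite !mxE rmorphD /= mulrDl.
Qed.

Lemma pairingB omega n m :
  pairing (n - m)%R omega = pairing n omega - pairing m omega.
Proof.
rewrite -[RHS]/(pairing n omega - pairing m omega)%R.
rewrite /pairing -sumrB /=; apply: eq_bigr => j _.
by rewrite !mxE rmorphB /= mulrBl.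
Qed.

Lemma pairing_le omega : exists2 Om, 0 <= Om &
  forall n, Rabs (pairing n omega) <= Om * bracket n.
Proof.
exists (\big[Rplus/0]_(j <- enum 'I_nu) Rabs (omega ord0 j)).
  by apply: rsum_ge0 => j; exact: Rabs_pos.
move=> n; have -> : pairing n omega =
    \big[Rplus/0]_(j <- enum 'I_nu) (((n ord0 j)%:~R)%R * omega ord0 j).
  by rewrite /pairing -big_enum.
elim: (enum _) => [|j l IH]; first by rewrite !big_nil Rabs_R0; lra.
rewrite !big_cons; apply: (Rle_trans _ _ _ (Rabs_triang _ _)).
rewrite Rmult_plus_distr_r; apply: Rplus_le_compat => //.
rewrite Rabs_mult Rmult_comm; apply: Rmult_le_compat_l; first exact: Rabs_pos.
have -> : Rabs (((n ord0 j)%:~R)%R) = INR (absz (n ord0 j)).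
  by rewrite INRE natr_absz RabsE intr_norm.
have /leP/le_INR := absz_le_l1norm n j; rewrite /bracket; lra.
Qed.

End Weights.

(** * Exponentials and complex-valued derivatives *)

Definition cis (a : R) : C := (cos a, sin a).

Lemma cisD a b : cis (a + b) = Cmult (cis a) (cis b).
Proof. by rewrite /cis cos_plus sin_plus /Cmult /=; congr (_, _); ring. Qed.

Lemma cis0 : cis 0 = RtoC 1.
Proof. by rewrite /cis cos_0 sin_0. Qed.

Lemma Cmod_cis a : Cmod (cis a) = 1.
Proof.
rewrite /Cmod /= -[RHS]sqrt_1; congr sqrt.
by have := sin2_cos2 a; rewrite /Rsqr; lra.
Qed.

(** The chord of an arc of length [d] is [2 sin (d / 2)]. *)
Lemma cis_lipschitz a b : Cmod (Cminus (cis a) (cis b)) <= Rabs (a - b).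
Proof.
rewrite -sqrt_Rsqr_abs; apply: sqrt_le_1_alt => /=.
set d := a - b.
have -> : (cos a + - cos b) * ((cos a + - cos b) * 1)
    + (sin a + - sin b) * ((sin a + - sin b) * 1) = 2 - 2 * cos d.
  rewrite /d cos_minus; have := sin2_cos2 a; have := sin2_cos2 b.
  by rewrite /Rsqr; lra.
have -> : d = 2 * (d / 2) by field.
rewrite cos_2a_sin.
have h : (sin (d / 2))² <= (d / 2)².
  apply: Rsqr_le_abs_1; set e := d / 2.
  case: (Rtotal_order e 0) => [en|[->|ep]]; last 2 first.
  - by rewrite sin_0; lra.
  - have h1 := sin_lt_x e ep.
    case: (Rle_lt_dec 0 (sin e)) => [h2|h2]; first by rewrite !Rabs_pos_eq; lra.
    rewrite (Rabs_left _ h2) (Rabs_pos_eq e); last lra.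
    case: (Rle_lt_dec 1 e) => [e1|e1]; first by have := SIN_bound e; lra.
    by have := sin_ge_0 e; have := PI2_1; lra.
  have h1 := sin_lt_x (- e); rewrite sin_neg in h1.
  have {}h1 : - sin e < - e by apply: h1; lra.
  case: (Rle_lt_dec 0 (- sin e)) => [h2|h2].
    by rewrite -(Rabs_Ropp (sin e)) -(Rabs_Ropp e) !Rabs_pos_eq; lra.
  rewrite (Rabs_pos_eq (sin e)) ?(Rabs_left e); try lra.
  case: (Rle_lt_dec 1 (- e)) => [e1|e1]; first by have := SIN_bound e; lra.
  by have := sin_ge_0 (- e); rewrite sin_neg; have := PI2_1; lra.
by move: h; rewrite /Rsqr; lra.
Qed.

Lemma Cmod_imag (a : R) : Cmod (0, a) = Rabs a.
Proof.
by rewrite /Cmod /= -sqrt_Rsqr_abs; congr sqrt; rewrite /Rsqr; ring.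
Qed.

(** An arbitrary filter serves both the spatial derivatives and the time
    derivatives taken along a closed interval. *)
Lemma filterdiff_C (F : (R -> Prop) -> Prop) (f : R -> C) (l : C) :
  Filter F ->
  filterdiff (U := R_NormedModule) (V := R_NormedModule)
    (fun y => (f y).1) F (fun h => scal h l.1) ->
  filterdiff (U := R_NormedModule) (V := R_NormedModule)
    (fun y => (f y).2) F (fun h => scal h l.2) ->
  filterdiff (U := R_NormedModule) (V := C_R_NormedModule)
    f F (fun h => scal h l).
Proof.
move=> FF h1 h2.
have L : is_linear (U := prod_NormedModule R_AbsRing R_NormedModule R_NormedModule)
    (V := C_R_NormedModule) (fun t => (t.1, t.2)).
  by apply: is_linear_prod; [exact: is_linear_fst|exact: is_linear_snd].
have H := @filterdiff_comp_2 R_AbsRing R_NormedModule R_NormedModule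
  R_NormedModule C_R_NormedModule F FF _ _ (fun a b => (a, b)) _ _
  (fun a b => (a, b)) h1 h2 (filterdiff_linear _ L).
apply: (filterdiff_ext_lin (fun y => ((f y).1, (f y).2) : C_R_NormedModule)) H _.
  done.
Qed.

Lemma filterdiff_Re (F : (R -> Prop) -> Prop) (f : R -> C) (l : C) :
  Filter F ->
  filterdiff (U := R_NormedModule) (V := C_R_NormedModule)
    f F (fun h => scal h l) ->
  filterdiff (U := R_NormedModule) (V := R_NormedModule)
    (fun y => (f y).1) F (fun h => scal h l.1).
Proof.
move=> FF h; have L := @is_linear_fst R_AbsRing R_NormedModule R_NormedModule.
exact: (@filterdiff_comp R_AbsRing R_NormedModule C_R_NormedModule
  R_NormedModule F FF f _ _ _ h (filterdiff_linear _ L)).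
Qed.

Lemma filterdiff_Im (F : (R -> Prop) -> Prop) (f : R -> C) (l : C) :
  Filter F ->
  filterdiff (U := R_NormedModule) (V := C_R_NormedModule)
    f F (fun h => scal h l) ->
  filterdiff (U := R_NormedModule) (V := R_NormedModule)
    (fun y => (f y).2) F (fun h => scal h l.2).
Proof.
move=> FF h; have L := @is_linear_snd R_AbsRing R_NormedModule R_NormedModule.
exact: (@filterdiff_comp R_AbsRing R_NormedModule C_R_NormedModule
  R_NormedModule F FF f _ _ _ h (filterdiff_linear _ L)).
Qed.

Lemma filterdiff_Cmult (F : (R -> Prop) -> Prop) (f : R -> C) (a l : C) :
  Filter F ->
  filterdiff (U := R_NormedModule) (V := C_R_NormedModule)
    f F (fun h => scal h l) ->
  filterdiff (U := R_NormedModule) (V := C_R_NormedModule)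
    (fun y => Cmult a (f y)) F (fun h => scal h (Cmult a l)).
Proof.
move=> FF h.
have scalC (k : R) (x : C) :
    Cmult a (scal k (x : C_R_NormedModule)) = scal k (Cmult a x : C_R_NormedModule).
  case: a x => a1 a2 [x1 x2].
  by apply: injective_projections; rewrite /scal /= /prod_scal /scal /= /mult /=; ring.
have L : is_linear (U := C_R_NormedModule) (V := C_R_NormedModule) (Cmult a).
  split=> [x y|k x|]; [exact: Cmult_plus_distr_l|exact: scalC|].
  exists (Cmod a + 1); split; first by have := Cmod_ge_0 a; lra.
  move=> x; rewrite !normC Cmod_mult; have := Cmod_ge_0 x; lra.
have H := @filterdiff_comp R_AbsRing R_NormedModule C_R_NormedModule
  C_R_NormedModule F FF f _ _ _ h (filterdiff_linear _ L).
apply: (filterdiff_ext_lin _ _ _ H) => k; exact: scalC.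
Qed.

Lemma is_derive_C_unique (f : R -> C) x (l l' : C) :
  is_derive (K := R_AbsRing) (V := C_R_NormedModule) f x l ->
  is_derive (K := R_AbsRing) (V := C_R_NormedModule) f x l' -> l = l'.
Proof.
have FF := nbhs_filter x.
move=> h h'; apply: injective_projections.
  have /is_derive_unique h1 := filterdiff_Re FF h.
  by have /is_derive_unique <- := filterdiff_Re FF h'.
have /is_derive_unique h1 := filterdiff_Im FF h.
by have /is_derive_unique <- := filterdiff_Im FF h'.
Qed.

Lemma is_derive_cis (la x : R) :
  is_derive (K := R_AbsRing) (V := C_R_NormedModule)
    (fun y => cis (la * y)) x (Cmult (0, la) (cis (la * x))).
Proof.
by apply: (filterdiff_C (nbhs_filter x)) => /=;
  rewrite -/(is_derive _ _ _); auto_derive => //; ring.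
Qed.

(** * Recovering a Fourier coefficient from point values *)

Section Functionals.

(** A finite combination of point evaluations, as pairs of a coefficient and a
    node.  Finiteness lets it commute with time derivatives of which nothing
    uniform in [x] is known. *)
Definition evalcomb (L : seq (C * R)) (f : R -> C) : C :=
  foldr (fun p s => Cplus (Cmult p.1 (f p.2)) s) (RtoC 0) L.

Lemma evalcomb_cat L L' f : evalcomb (L ++ L') f = Cplus (evalcomb L f) (evalcomb L' f).
Proof. by elim: L => [|p L IH] /=; rewrite ?IH; ring. Qed.

Lemma evalcomb_ext L f g : f =1 g -> evalcomb L f = evalcomb L g.
Proof. by move=> fg; elim: L => [|p L IH] //=; rewrite fg IH. Qed.

Lemma evalcomb_Cmult L a f : evalcomb L (fun x => Cmult a (f x)) = Cmult a (evalcomb L f).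
Proof. by elim: L => [|p L IH] /=; rewrite ?IH; ring. Qed.

Lemma evalcomb_eq0 La (f : R -> C) : (forall x, f x = RtoC 0) -> evalcomb La f = RtoC 0.
Proof. by move=> f0; elim: La => [|p l IH] //=; rewrite IH f0; ring. Qed.

Lemma is_usum_evalcomb (T : eqType) L (f : T -> R -> C) (G : R -> C) :
  (forall x, is_usum (V := C_R_NormedModule) (fun n => f n x) (G x)) ->
  is_usum (V := C_R_NormedModule) (fun n => evalcomb L (f n)) (evalcomb L G).
Proof.
move=> h; elim: L => [|p L IH]; first exact: is_usum0.
exact: (is_usum_plus (is_usum_Cmult p.1 (h p.2)) IH).
Qed.

Lemma filterdiff_evalcomb (F : (R -> Prop) -> Prop) L (w : R -> R -> C)
    (w' : R -> C) :
  Filter F ->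
  (forall x, filterdiff (U := R_NormedModule) (V := C_R_NormedModule)
    (fun s => w s x) F (fun h => scal h (w' x))) ->
  filterdiff (U := R_NormedModule) (V := C_R_NormedModule)
    (fun s => evalcomb L (w s)) F (fun h => scal h (evalcomb L w')).
Proof.
move=> FF h; elim: L => [|p L IH].
  apply: (filterdiff_ext_lin (fun _ => RtoC 0 : C_R_NormedModule) (fun _ => zero)).
    exact: filterdiff_const.
  by move=> y; rewrite scal_zero_r.
have h1 := @filterdiff_plus_fct R_AbsRing R_NormedModule C_R_NormedModule F FF
  _ _ _ _ (filterdiff_Cmult p.1 FF (h p.2)) IH.
apply: (filterdiff_ext_lin _ _ _ h1) => y.
by rewrite -scal_distr_l.
Qed.

(** Averaging with the translate by [h] multiplies the response at [th] by
    [(1 + cis (th * h)) / 2], whose modulus is at most [1] and whose value is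
    [1] at [th = 0]; the choice [h = PI / th0] makes it vanish at [th0]. *)
Lemma annihilating_comb (F : seq R) : {in F, forall th, th <> 0} ->
  exists L, evalcomb L (fun x => cis (0 * x)) = RtoC 1 /\
    (forall th, Cmod (evalcomb L (fun x => cis (th * x))) <= 1) /\
    {in F, forall th, evalcomb L (fun x => cis (th * x)) = RtoC 0}.
Proof.
elim: F => [|th0 F IH] F0.
  exists [:: (RtoC 1, 0)] => /=; rewrite !Rmult_0_r cis0.
  split; first by ring.
  split=> // th; rewrite Rmult_0_r cis0 Cplus_0_r Cmult_1_r Cmod_1; lra.
have [L [L1 [Lb L0]]] := IH (fun th h => F0 th (@mem_behead _ (th0 :: F) th h)).
have th00 : th0 <> 0 by apply: F0; rewrite mem_head.
pose h := PI / th0.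
pose L' := [seq (Cmult (RtoC (1/2)) p.1, p.2 + h) | p <- L].
pose L'' := [seq (Cmult (RtoC (1/2)) p.1, p.2) | p <- L].
have main th : evalcomb (L'' ++ L') (fun x => cis (th * x)) =
    Cmult (evalcomb L (fun x => cis (th * x)))
      (Cmult (RtoC (1/2)) (Cplus (RtoC 1) (cis (th * h)))).
  rewrite evalcomb_cat /L' /L''; elim: (L) => [|p l IHl] /=; first by ring.
  rewrite Rmult_plus_distr_l cisD.
  transitivity (Cplus (Cmult (Cmult p.1 (cis (th * p.2)))
    (Cmult (RtoC (1/2)) (Cplus (RtoC 1) (cis (th * h)))))
   (Cplus (evalcomb [seq (Cmult (RtoC (1/2)) p0.1, p0.2) | p0 <- l] (fun x => cis (th * x)))
    (evalcomb [seq (Cmult (RtoC (1/2)) p0.1, p0.2 + h) | p0 <- l]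
       (fun x => cis (th * x))))).
    by ring.
  by rewrite IHl; ring.
exists (L'' ++ L'); split; last split.
- rewrite main L1 Rmult_0_l cis0 Cmult_1_l -RtoC_plus -RtoC_mult.
  by congr RtoC; field.
- move=> th; rewrite main !Cmod_mult Cmod_R Rabs_pos_eq; last lra.
  have := Cmod_triangle (RtoC 1) (cis (th * h)); rewrite Cmod_1 Cmod_cis.
  have := Lb th; have := Cmod_ge_0 (evalcomb L (fun x => cis (th * x))).
  have := Cmod_ge_0 (Cplus (RtoC 1) (cis (th * h))).
  by move=> *; nra.
- move=> th; rewrite in_cons main => /orP[/eqP ->|/L0 ->]; last by ring.
  have -> : th0 * h = PI by rewrite /h; field.
  rewrite /cis cos_PI sin_PI.
  by rewrite /Cmult /Cplus /RtoC /=; congr (_, _); ring.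
Qed.

(** The modes of a finite list are annihilated and the remaining ones
    contribute a tail of [B].  Nonresonance says that distinct modes have
    distinct frequencies.  The combination is chosen before the series, and the
    error is proportional to its size [k], which later is a small time. *)
Lemma evalcomb_coef_approx nu (omega : 'rV[R]_nu) (n : 'rV[int]_nu)
    (B : 'rV[int]_nu -> R) eps :
  nonresonant omega -> summable B -> 0 < eps ->
  exists L, forall (a : 'rV[int]_nu -> C) (f : R -> C) (k : R),
    0 <= k -> (forall m, Cmod (a m) <= k * B m) ->
    (forall x, is_fourier_sum omega a x (f x)) ->
    Cmod (Cminus (evalcomb L f) (a n)) <= k * eps.
Proof.
move=> nr sB e0; have [l0 [u0 tail]] := summable_tail sB e0.
pose fr m := pairing m omega - pairing n omega.
have [|L [L1 [Lb L0]]] := @annihilating_comb [seq fr m | m <- l0 & m != n].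
  move=> th /mapP[m]; rewrite mem_filter => /andP[/eqP mn _] -> h.
  apply: mn; apply/eqP; rewrite -subr_eq0; apply/eqP/(nr).
  by rewrite pairingB.
pose La := [seq (Cmult p.1 (cis (- pairing n omega * p.2)), p.2) | p <- L].
have LaE m : evalcomb La (fun x => cis (pairing m omega * x))
    = evalcomb L (fun x => cis (fr m * x)).
  rewrite /La; elim: (L) => [|p l IH] //=; rewrite IH; congr Cplus.
  rewrite -Cmult_assoc -cisD; congr (Cmult _ (cis _)).
  by rewrite /fr; ring.
exists La => a f k k0 aB hf.
pose mu m := evalcomb La (fun x => cis (pairing m omega * x)).
have mu1 : mu n = RtoC 1.
  by rewrite /mu LaE -L1; apply: evalcomb_ext => x; rewrite /fr Rminus_diag.
have hs := is_usum_evalcomb La hf.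
(* The series of the error: mode n is removed, those of l0 are annihilated. *)
pose g m : C := if m == n then zero else Cmult (a m) (mu m).
have hg : is_usum (V := C_R_NormedModule) g (minus (evalcomb La f) (a n) : C_R_NormedModule).
  have h1 : is_usum (V := C_R_NormedModule)
      (fun m => if m == n then a n else zero) (a n).
    have := @is_usum_finite _ C_R_NormedModule
      (fun m => if m == n then a n else zero) [:: n] isT.
    rewrite psum_cons psum_nil eqxx plus_zero_r; apply=> m.
    by rewrite inE => /negbTE ->.
  apply: is_usum_ext (is_usum_minus hs h1) => m.
  rewrite /g /mode evalcomb_Cmult -/(mu m).
  case: eqP => [->|_]; last by rewrite minus_zero_r.
  by rewrite mu1 Cmult_1_r minus_eq_zero.
have gB m : norm (g m : C_R_NormedModule) <= k * B m.
  rewrite /g; case: eqP => _.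
    rewrite norm_zero; apply: Rmult_le_pos => //; by case: sB.
  rewrite normC Cmod_mult; have := aB m; have := Lb (fr m); rewrite -LaE.
  by have := Cmod_ge_0 (a m); rewrite -/(mu m); move=> *; nra.
have tail' l : uniq l -> {in l, forall m, m \notin l0} ->
    \big[Rplus/0]_(m <- l) (k * B m) <= k * eps.
  by move=> ul dl; rewrite rsum_mulr; apply: Rmult_le_compat_l => //; apply: tail.
have := is_usum_tail hg gB u0 tail'.
rewrite psum0; last first.
  move=> m ml; rewrite /g; case: eqP => // /eqP mn.
  have -> : mu m = RtoC 0.
    rewrite /mu LaE; apply: L0; apply/mapP; exists m => //.
    by rewrite mem_filter mn.
  by rewrite Cmult_0_r.
by rewrite norm_minusC minus_zero_r normC.
Qed.

End Functionals.

(** * Fourier series and convolution *)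

Lemma mode_mult nu (omega : 'rV[R]_nu) m n a b x :
  Cmult (mode omega m a x) (mode omega n b x) =
  mode omega (m + n)%R (Cmult a b) x.
Proof.
rewrite /mode -!/(cis _) pairingD Rmult_plus_distr_r cisD; ring.
Qed.

Lemma Cmod_mode nu (omega : 'rV[R]_nu) n a x : Cmod (mode omega n a x) = Cmod a.
Proof. by rewrite /mode -/(cis _) Cmod_mult Cmod_cis Rmult_1_r. Qed.

Lemma mode_scal nu (omega : 'rV[R]_nu) n a x :
  mode omega n a x = Cmult (mode omega n (RtoC 1) x) a.
Proof. rewrite /mode -/(cis _); ring. Qed.

Lemma mode_minus nu (omega : 'rV[R]_nu) n a b x : mode omega n (Cminus a b) x =
  Cminus (mode omega n a x) (mode omega n b x).
Proof. by rewrite /mode; ring. Qed.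

Lemma mode_plus nu (omega : 'rV[R]_nu) n a b x : mode omega n (Cplus a b) x =
  Cplus (mode omega n a x) (mode omega n b x).
Proof. by rewrite /mode; ring. Qed.

Lemma fourier_sum_minus nu (omega : 'rV[R]_nu) (a b : 'rV[int]_nu -> C) x s s' :
  is_fourier_sum omega a x s -> is_fourier_sum omega b x s' ->
  is_fourier_sum omega (fun n => Cminus (a n) (b n)) x (Cminus s s').
Proof.
move=> ha hb; apply: is_usum_ext (is_usum_minus ha hb) => n.
exact/esym/mode_minus.
Qed.

Lemma fourier_sum_plus nu (omega : 'rV[R]_nu) (a b : 'rV[int]_nu -> C) x s s' :
  is_fourier_sum omega a x s -> is_fourier_sum omega b x s' ->
  is_fourier_sum omega (fun n => Cplus (a n) (b n)) x (Cplus s s').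
Proof.
move=> ha hb; apply: is_usum_ext (is_usum_plus ha hb) => n.
exact/esym/mode_plus.
Qed.

(** The index type is arbitrary since the series are indexed by the lattice in
    one use and by pairs of a degree and a lattice point in another. *)
Lemma is_derive_mode_usum (T : eqType) nu (omega : 'rV[R]_nu)
    (fr : T -> 'rV[int]_nu) (a : T -> C) (B : T -> R) (F : R -> C) x (s : C) :
  summable B ->
  (forall p, Rabs (pairing (fr p) omega) * Cmod (a p) <= B p) ->
  (forall y, is_usum (V := C_R_NormedModule)
    (fun p => mode omega (fr p) (a p) y) (F y)) ->
  is_usum (V := C_R_NormedModule)
    (fun p => mode omega (fr p) (Cmult (0, pairing (fr p) omega) (a p)) x) s ->
  is_derive (K := R_AbsRing) (V := C_R_NormedModule) F x s.
Proof.
move=> sB aB hF hs.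
apply: (@is_derive_usum _ C_R_NormedModule (fun p y => mode omega (fr p) (a p) y)
  _ B F s x 1 sB _ _ _ _ _ hs).
- lra.
- by move=> y _; exact: hF.
- move=> p; have h1 := filterdiff_Cmult (a p) (nbhs_filter x)
    (is_derive_cis (pairing (fr p) omega) x).
  have -> : mode omega (fr p) (Cmult (0, pairing (fr p) omega) (a p)) x
      = Cmult (a p) (Cmult (0, pairing (fr p) omega)
          (cis (pairing (fr p) omega * x))).
    by rewrite /mode -/(cis _); ring.
  exact: h1.
- move=> p y _; rewrite normC.
  rewrite -[minus _ _]/(Cminus (mode omega (fr p) (a p) y)
    (mode omega (fr p) (a p) x)).
  have -> : Cminus (mode omega (fr p) (a p) y) (mode omega (fr p) (a p) x)
     = Cmult (a p) (Cminus (cis (pairing (fr p) omega * y))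
         (cis (pairing (fr p) omega * x))).
    by rewrite /mode -!/(cis _); ring.
  rewrite Cmod_mult.
  apply: (Rle_trans _ (Cmod (a p)
      * (Rabs (pairing (fr p) omega) * Rabs (y - x)))).
    apply: Rmult_le_compat_l; first exact: Cmod_ge_0.
    by rewrite -Rabs_mult Rmult_minus_distr_l; exact: cis_lipschitz.
  rewrite -Rmult_assoc; apply: Rmult_le_compat_r; first exact: Rabs_pos.
  by rewrite Rmult_comm.
- by move=> p; rewrite normC Cmod_mode Cmod_mult Cmod_imag.
Qed.

Section Convolution.
Variables (nu : nat) (r : R).
Hypotheses (nu0 : (0 < nu)%N) (hr : INR nu < r).
Implicit Types (f g : 'rV[int]_nu -> C) (n m : 'rV[int]_nu).

Definition lattice_conv f g n : C :=
  usum (V := C_R_CompleteNormedModule) (fun m => Cmult (f m) (g (n - m)%R)).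

Variables (f g : 'rV[int]_nu -> C) (a b : R).
Hypotheses (fB : forall n, Cmod (f n) <= a * weight r n)
           (gB : forall n, Cmod (g n) <= b * weight r n).

Let a_ge0 : 0 <= a.
Proof.
have := fB 0%R; have := weight_gt0 r (0 : 'rV[int]_nu)%R.
by have := Cmod_ge_0 (f 0%R); move=> *; nra.
Qed.

Let b_ge0 : 0 <= b.
Proof.
have := gB 0%R; have := weight_gt0 r (0 : 'rV[int]_nu)%R.
by have := Cmod_ge_0 (g 0%R); move=> *; nra.
Qed.

Let r_ge0 : 0 <= r. Proof. by have := pos_INR nu; lra. Qed.

Let term_le n m : norm (Cmult (f m) (g (n - m)%R) : C_R_NormedModule)
  <= a * b * (weight r m * weight r (n - m)%R).
Proof.
rewrite normC Cmod_mult.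
rewrite (_ : a * b * _ = (a * weight r m) * (b * weight r (n - m)%R)); last ring.
by apply: Rmult_le_compat => //; exact: Cmod_ge_0.
Qed.

Lemma lattice_conv_usum n : is_usum (V := C_R_NormedModule)
  (fun m => Cmult (f m) (g (n - m)%R)) (lattice_conv f g n).
Proof.
have sB := summable_mulr (Rmult_le_pos _ _ a_ge0 b_ge0) (summable_weight nu0 hr).
apply: (is_usum_usum (V := C_R_CompleteNormedModule) sB) => m.
apply: Rle_trans (term_le n m) _; apply: Rmult_le_compat_l.
  exact: Rmult_le_pos.
have := weight_le1 (n - m)%R r_ge0; have := weight_ge0 r m.
by move=> *; nra.
Qed.

Lemma lattice_conv_le n : Cmod (lattice_conv f g n) <= a * b * (Kconst r nu * weight r n).
Proof.
rewrite -normC; apply: (is_usum_norm_le (lattice_conv_usum n) (term_le n)) => l ul.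
rewrite rsum_mulr; apply: Rmult_le_compat_l; first exact: Rmult_le_pos.
exact: weight_conv_le.
Qed.

(** Regroup the double series over [(m, m')] according to [m + m']. *)
Lemma fourier_sum_mult omega x s1 s2 :
  is_fourier_sum omega f x s1 -> is_fourier_sum omega g x s2 ->
  is_fourier_sum omega (lattice_conv f g) x (Cmult s1 s2).
Proof.
move=> h1 h2; have sw := summable_weight nu0 hr.
have s1B := summable_mulr a_ge0 sw; have s2B := summable_mulr b_ge0 sw.
have h := is_usum_mult s1B s2B _ _ h1 h2.
have {}h := h _ _; rewrite /is_fourier_sum.
apply: (is_usum_regroup (pi := fun p => (p.1 + p.2)%R) (summable_prod s1B s2B)
  _ (h _ _)).
- move=> p; rewrite normC Cmod_mult !Cmod_mode.
  by apply: Rmult_le_compat => //; exact: Cmod_ge_0.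
- by move=> n; rewrite Cmod_mode.
- by move=> n; rewrite Cmod_mode.
move=> n; apply: (is_usum_reindex (phi := fun m => (m, n - m)%R) (psi := fst)).
- by [].
- move=> [m m'] /= hne; case: eqP => // e; case/negP: hne.
  by rewrite -e addrC addKr.
rewrite mode_scal.
apply: is_usum_ext (is_usum_Cmult (mode omega n (RtoC 1) x) (lattice_conv_usum n)) => m /=.
have -> : (m + (n - m))%R = n by rewrite addrC subrK.
rewrite eqxx mode_mult (_ : (m + (n - m))%R = n); last by rewrite addrC subrK.
exact/esym/mode_scal.
Qed.

End Convolution.

(** * Series in powers of time and spatial modes *)

Lemma linear_geometric_le q b : 0 < q < b -> exists c, 0 <= c /\
  forall k, (INR k + 1) * pow q k <= c * pow b k.
Proof.
move=> qb.
(* Bernoulli gives (b / q)^k >= 1 + k th, and c absorbs both terms of k + 1. *)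
pose th := b / q - 1.
have th0 : 0 < th.
  suff : 1 < b / q by rewrite /th; lra.
  by apply: (Rmult_lt_reg_r q); [lra|rewrite /Rdiv Rmult_assoc Rinv_l; lra].
pose c := Rmax 1 (/ th); exists c.
have c1 : 1 <= c := Rmax_l _ _.
have ct : 1 <= c * th.
  apply: (Rle_trans _ (/ th * th)); first by rewrite Rinv_l; lra.
  by apply: Rmult_le_compat_r; [lra|exact: Rmax_r].
split=> [|k]; first lra.
have qk : 0 < pow q k by apply: pow_lt; lra.
have -> : pow b k = pow (1 + th) k * pow q k.
  rewrite -Rpow_mult_distr; congr pow; rewrite /th; field; lra.
have := Rfunctions.poly k th th0; have := pos_INR k; move=> k0 h.
have : INR k + 1 <= c * pow (1 + th) k by nra.
by move=> *; nra.
Qed.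

Lemma pow_lipschitz k s t rho : Rabs s <= rho -> Rabs t <= rho ->
  Rabs (pow s k - pow t k) <= INR k * pow rho k.-1 * Rabs (s - t).
Proof.
move=> hs ht; have r0 : 0 <= rho by have := Rabs_pos s; lra.
elim: k => [|k IH]; first by rewrite /= Rminus_diag Rabs_R0; lra.
have -> : pow s k.+1 - pow t k.+1 = s * (pow s k - pow t k) + (s - t) * pow t k.
  by rewrite /=; ring.
apply: (Rle_trans _ _ _ (Rabs_triang _ _)); rewrite !Rabs_mult S_INR -RPow_abs.
have hp : pow (Rabs t) k <= pow rho k.
  by apply: pow_incr; split=> //; exact: Rabs_pos.
have st := Rabs_pos (s - t).
have h1 : Rabs s * Rabs (pow s k - pow t k) <= INR k * pow rho k * Rabs (s - t).
  apply: (Rle_trans _ (rho * (INR k * pow rho k.-1 * Rabs (s - t)))).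
    by apply: Rmult_le_compat => //; exact: Rabs_pos.
  case: (k) => [|k'] /=; first by lra.
  right; ring.
by rewrite [_.-1]/=; nra.
Qed.

Section PowerSeries.
Variables (nu : nat) (omega : 'rV[R]_nu) (M : R).
Hypothesis M1 : 1 <= M.
Local Notation family := (nat -> 'rV[int]_nu -> C).
Implicit Types (al : family) (W : 'rV[int]_nu -> R).

(** Growth in the first index at every rate above [M]: leaving the margin open
    makes the class absorb polynomial factors, hence stable under [coef_dt]. *)
Definition exp_growth W al : Prop :=
  forall b, M < b -> exists c, 0 <= c /\
    forall k n, Cmod (al k n) <= c * pow b k * W n.

Definition pterm al (t x : R) (p : nat * 'rV[int]_nu) : C :=
  mode omega p.2 (Cmult (al p.1 p.2) (RtoC (pow t p.1))) x.

Definition pseries al (t x : R) : C :=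
  usum (V := C_R_CompleteNormedModule) (pterm al t x).

(** Differentiation acts on the coefficients, so that every derivative of a
    series is again a series of the same form. *)
Definition coef_dt al : family :=
  fun k n => Cmult (RtoC (INR k + 1)) (al k.+1 n).

Definition coef_dx al : family := fun k n => Cmult (0, pairing n omega) (al k n).

(** Larger than the lifespan [1 / (5 M)], so that both ends of the time interval
    are interior points, and smaller than the radius of convergence [1 / M]. *)
Definition radius := / (4 * M).

Lemma exp_growth_dt W al : (forall n, 0 <= W n) -> exp_growth W al ->
  exp_growth W (coef_dt al).
Proof.
move=> W0 h b Mb; pose b' := (M + b) / 2.
have [|c [c0 hc]] := h b'; first by rewrite /b'; lra.
have [|e [e0 he]] := @linear_geometric_le b' b; first by rewrite /b'; lra.
have b0 : 0 < b' by rewrite /b'; lra.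
exists (c * b' * e); split; first by apply: Rmult_le_pos => //; nra.
move=> k n; rewrite /coef_dt Cmod_mult Cmod_R.
have k0 := pos_INR k; rewrite Rabs_pos_eq; last lra.
apply: (Rle_trans _ ((INR k + 1) * (c * pow b' k.+1 * W n))).
  by apply: Rmult_le_compat_l => //; lra.
have -> : (INR k + 1) * (c * pow b' k.+1 * W n)
  = c * b' * W n * ((INR k + 1) * pow b' k) by rewrite /=; ring.
have -> : c * b' * e * pow b k * W n = c * b' * W n * (e * pow b k) by ring.
apply: Rmult_le_compat_l => //.
by apply: Rmult_le_pos => //; nra.
Qed.

Lemma exp_growth_dx W al : (forall n, 0 <= W n) -> exp_growth W al ->
  exp_growth (fun n => bracket n * W n) (coef_dx al).
Proof.
move=> W0 h b Mb; have [c [c0 hc]] := h b Mb.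
have [Om Om0 hOm] := pairing_le omega.
exists (Om * c); split=> [|k n]; first exact: Rmult_le_pos.
rewrite /coef_dx Cmod_mult Cmod_imag.
have -> : Om * c * pow b k * (bracket n * W n)
  = (Om * bracket n) * (c * pow b k * W n) by ring.
by apply: Rmult_le_compat => //; [exact: Rabs_pos|exact: Cmod_ge_0].
Qed.

Let radius_gt0 : 0 < radius.
Proof. by apply: Rinv_0_lt_compat; lra. Qed.

Lemma Cmod_pterm al t x p :
  Cmod (pterm al t x p) = Cmod (al p.1 p.2) * pow (Rabs t) p.1.
Proof. by rewrite /pterm Cmod_mode Cmod_mult Cmod_R RPow_abs. Qed.

Lemma pterm_bound W al : summable W -> exp_growth W al ->
  exists2 B, summable B &
    forall t x p, Rabs t <= radius -> Cmod (pterm al t x p) <= B p.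
Proof.
move=> [W0 sW] h.
(* At the ratio 2 M the terms decay like (2 M radius)^k = 2^-k. *)
have [|c [c0 hc]] := h (2 * M); first lra.
exists (fun p => c * (pow (/2) p.1 * W p.2)).
  apply: summable_mulr => //.
  by apply: (summable_prod (@summable_geometric (/2) _)) => //; lra.
move=> t x p tr; rewrite Cmod_pterm.
apply: (Rle_trans _ (c * pow (2 * M) p.1 * W p.2 * pow radius p.1)).
  apply: Rmult_le_compat => //; first exact: Cmod_ge_0.
    by apply: pow_le; exact: Rabs_pos.
  by apply: pow_incr; split=> //; exact: Rabs_pos.
have -> : / 2 = 2 * M * radius by rewrite /radius; field; lra.
by rewrite (Rpow_mult_distr (2 * M)); right; ring.
Qed.

Lemma pseries_usum W al t x : summable W -> exp_growth W al -> Rabs t <= radius ->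
  is_usum (V := C_R_NormedModule) (pterm al t x) (pseries al t x).
Proof.
move=> sW h tr; have [B sB hB] := pterm_bound sW h.
apply: (is_usum_usum (V := C_R_CompleteNormedModule) sB) => p.
by have := hB t x p tr; rewrite -normC.
Qed.

Lemma is_derive_pow_C k t (a : C) :
  is_derive (K := R_AbsRing) (V := C_R_NormedModule)
    (fun s => Cmult a (RtoC (pow s k))) t
    (Cmult a (RtoC (INR k * pow t k.-1))).
Proof.
have FF := nbhs_filter t.
apply: (filterdiff_Cmult a FF (f := fun s => RtoC (pow s k))
  (l := RtoC (INR k * pow t k.-1))).
apply: (filterdiff_C FF) => /=; rewrite -/(is_derive _ _ _).
  by auto_derive => //; ring.
exact: is_derive_const.
Qed.

(** Differentiating a monomial costs a factor [k] and lowers the degree by one;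
    the former is absorbed by the margin in the radius, the latter is undone by
    reindexing. *)
Lemma pseries_dt W al t x : summable W -> exp_growth W al -> Rabs t < radius ->
  is_derive (K := R_AbsRing) (V := C_R_NormedModule)
    (fun s => pseries al s x) t (pseries (coef_dt al) t x).
Proof.
move=> sW h tr; have [W0 _] := sW.
have rr0 := radius_gt0.
(* Here 3 M / 2 * radius = 3 / 8, and the gap to 1 / 2 absorbs the factor k. *)
have [|c [c0 hc]] := h (3 * M / 2); first lra.
have [|e [e0 he]] := @linear_geometric_le (3 / 8) (/ 2); first lra.
pose B (p : nat * 'rV[int]_nu) := (c * e * / radius) * (pow (/ 2) p.1 * W p.2).
have sB : summable B.
  apply: summable_mulr.
    by apply: Rmult_le_pos; [exact: Rmult_le_pos|apply/Rlt_le/Rinv_0_lt_compat].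
  by apply: (summable_prod (@summable_geometric (/2) _)) => //; lra.
have key k n : Cmod (al k n) * (INR k * pow radius k.-1) <= B (k, n).
  have i0 : 0 < / radius by exact: Rinv_0_lt_compat.
  have h1 : INR k * pow radius k.-1 <= / radius * ((INR k + 1) * pow radius k).
    have rk : 0 <= pow radius k by apply: pow_le; lra.
    case: k rk => [|k] rk; first by rewrite /= Rmult_0_l; nra.
    have -> : / radius * ((INR k.+1 + 1) * pow radius k.+1)
      = (INR k.+1 + 1) * pow radius k by rewrite /=; field; lra.
    have := pos_INR k.+1; have : 0 <= pow radius k by apply: pow_le; lra.
    by rewrite [_.-1]/=; nra.
  apply: (Rle_trans _ (c * pow (3 * M / 2) k * W n
      * (/ radius * ((INR k + 1) * pow radius k)))).
    apply: Rmult_le_compat => //; first exact: Cmod_ge_0.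
    apply: Rmult_le_pos; first exact: pos_INR.
    by apply: pow_le; lra.
  have -> : c * pow (3 * M / 2) k * W n * (/ radius * ((INR k + 1) * pow radius k))
    = (c * / radius * W n) * ((INR k + 1) * pow (3 / 8) k).
    have -> : 3 / 8 = 3 * M / 2 * radius by rewrite /radius; field; lra.
    by rewrite (Rpow_mult_distr (3 * M / 2)); ring.
  have -> : B (k, n) = (c * / radius * W n) * (e * pow (/ 2) k).
    by rewrite /B /=; ring.
  apply: Rmult_le_compat_l; last exact: he.
  by apply: Rmult_le_pos => //; apply: Rmult_le_pos => //; lra.
pose d := radius - Rabs t.
have near y : Rabs (y - t) < d -> Rabs y <= radius.
  move=> yd; have := Rabs_triang (y - t) t.
  by rewrite (_ : y - t + t = y); last ring; move: yd; rewrite /d; lra.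
pose f' (p : nat * 'rV[int]_nu) : C :=
  mode omega p.2 (Cmult (al p.1 p.2) (RtoC (INR p.1 * pow t p.1.-1))) x.
apply: (@is_derive_usum _ C_R_NormedModule (fun p s => pterm al s x p) f' B
  (fun s => pseries al s x) _ t d sB).
- by rewrite /d; lra.
- by move=> y yd; apply: (pseries_usum x sW h); exact: near.
- move=> [k n]; rewrite /f' /=.
  have FF := nbhs_filter t.
  have := filterdiff_Cmult (mode omega n (RtoC 1) x) FF
    (is_derive_pow_C k t (al k n)).
  rewrite -mode_scal; apply: filterdiff_ext => y.
  by rewrite /pterm -mode_scal.
- move=> [k n] y yd.
  rewrite normC.
  have -> : minus (pterm al y x (k, n) : C_R_NormedModule) (pterm al t x (k, n))
      = mode omega n (Cmult (al k n) (RtoC (pow y k - pow t k))) x.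
    rewrite -[LHS]/(Cminus (pterm al y x (k, n)) (pterm al t x (k, n))).
    by rewrite /pterm /mode /= RtoC_minus; ring.
  rewrite Cmod_mode Cmod_mult Cmod_R.
  have h1 := @pow_lipschitz k y t radius (near _ yd) _.
  apply: (Rle_trans _ (Cmod (al k n) * (INR k * pow radius k.-1 * Rabs (y - t)))).
    by apply: Rmult_le_compat_l; [exact: Cmod_ge_0|apply: h1; lra].
  rewrite -Rmult_assoc; apply: Rmult_le_compat_r; first exact: Rabs_pos.
  exact: key.
- move=> [k n]; rewrite normC /f' Cmod_mode Cmod_mult Cmod_R /=.
  apply: Rle_trans (key k n); apply: Rmult_le_compat_l; first exact: Cmod_ge_0.
  rewrite Rabs_mult Rabs_pos_eq; last exact: pos_INR.
  apply: Rmult_le_compat_l; first exact: pos_INR.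
  rewrite -RPow_abs; apply: pow_incr; split; [exact: Rabs_pos|lra].
- apply: (is_usum_reindex (phi := fun p => (p.1.+1, p.2))
    (psi := fun p => (p.1.-1, p.2))).
  + by move=> [k n].
  + move=> [[|k] n] /=; last by rewrite eqxx.
    by move=> _; rewrite /f' /= Rmult_0_l Cmult_0_r mode_scal Cmult_0_r.
  have hs := exp_growth_dt W0 h.
  have := pseries_usum x sW hs (Rlt_le _ _ tr); apply: is_usum_ext => -[k n].
  rewrite /pterm /f' /coef_dt [_.1]/= [_.2]/= S_INR /=.
  by rewrite RtoC_mult; congr mode; ring.
Qed.

Lemma pseries_dx W al t x : summable (fun n => bracket n * W n) ->
  (forall n, 0 <= W n) -> exp_growth W al -> Rabs t <= radius ->
  is_derive (K := R_AbsRing) (V := C_R_NormedModule)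
    (fun y => pseries al t y) x (pseries (coef_dx al) t x).
Proof.
move=> sW W0 h tr; have hd := exp_growth_dx W0 h.
have sW' : summable W.
  apply: (summable_le _ sW) => n; split=> //.
  by have := bracket_ge1 n; have := W0 n; nra.
have [B sB hB] := pterm_bound sW hd.
apply: (is_derive_mode_usum (fr := snd) sB _
  (fun y => pseries_usum y sW' h tr)) => [p|].
  have := hB t x p tr; rewrite Cmod_pterm /coef_dx Cmod_mult Cmod_imag.
  by rewrite Cmod_mult Cmod_R RPow_abs Rmult_assoc.
apply: is_usum_ext (pseries_usum x sW hd tr) => p.
by rewrite /pterm /coef_dx Cmult_assoc.
Qed.

End PowerSeries.

Section PowerSeriesContinuity.
Variables (nu : nat) (omega : 'rV[R]_nu) (M : R).
Hypothesis M1 : 1 <= M.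
Implicit Types (al : nat -> 'rV[int]_nu -> C) (W : 'rV[int]_nu -> R).

Lemma continuous_pterm al p (q : R * R) :
  continuous (T := prod_UniformSpace R_UniformSpace R_UniformSpace)
    (U := C_R_NormedModule) (fun q => pterm omega al q.1 q.2 p) q.
Proof.
case: p => k n.
apply: (continuous_ext (fun q : prod_UniformSpace R_UniformSpace R_UniformSpace =>
  scal (pow q.1 k) (Cmult (al k n) (cis (pairing n omega * q.2)) : C_R_NormedModule))).
  move=> [t x]; rewrite /pterm /mode /= -/(cis _) /scal /= /prod_scal /scal /= /mult /=.
  by apply: injective_projections => /=; ring.
apply: (continuous_scal (K := R_AbsRing) (V := C_R_NormedModule)).
  apply: (continuous_comp (U := prod_UniformSpace R_UniformSpace R_UniformSpace)
    (V := R_UniformSpace) (W := R_UniformSpace) fst (fun t => pow t k)).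
    exact: continuous_fst.
  apply: (ex_derive_continuous (K := R_AbsRing) (V := R_NormedModule)).
  by auto_derive.
apply: (continuous_comp (U := prod_UniformSpace R_UniformSpace R_UniformSpace)
  (V := R_UniformSpace) (W := C_R_NormedModule) snd
  (fun x => Cmult (al k n) (cis (pairing n omega * x)))).
  exact: continuous_snd.
apply: (ex_derive_continuous (K := R_AbsRing) (V := C_R_NormedModule)).
by eexists; apply: filterdiff_Cmult; exact: is_derive_cis.
Qed.

Lemma pseries_continuous L W al : L <= radius M -> summable W -> exp_growth M W al ->
  continuous_on_strip L (pseries omega al).
Proof.
move=> Lr sW h [t x] [/= t0 tL].
have [B sB hB] := pterm_bound omega M1 sW h.
have inr s : 0 <= s <= L -> Rabs s <= radius M.
  by move=> s0; rewrite Rabs_pos_eq; lra.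
have FF := @filter_filter _ _ (locally_filter
  ((t, x) : prod_UniformSpace R_UniformSpace R_UniformSpace)).
have FW := within_filter _ (strip L) _ FF.
apply: (@filterlim_usum _ C_R_NormedModule _ _
  (fun p q => pterm omega al q.1 q.2 p) (pterm omega al t x) B _ _ FW).
- by [].
- move=> p; exact: (filterlim_filter_le_1 _
    (@filter_le_within _ _ FF (strip L)) (@continuous_pterm al p (t, x))).
- rewrite /within; apply: (@filter_forall _ _ FF) => -[s y] [/= s0 sL]; split.
    by move=> p; rewrite normC; apply: hB; apply: inr.
  by apply: (pseries_usum omega M1 y sW h); apply: inr.
- by move=> p; rewrite normC; apply: hB; apply: inr.
- by apply: (pseries_usum omega M1 x sW h); apply: inr.
Qed.

End PowerSeriesContinuity.

Section GradedConvolution.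
Variables (nu : nat) (omega : 'rV[R]_nu) (M A r : R).
Hypotheses (nu0 : (0 < nu)%N) (hr : INR nu < r) (M1 : 1 <= M) (A0 : 0 <= A).
Variable P : nat -> 'rV[int]_nu -> C.

Definition graded_conv (P : nat -> 'rV[int]_nu -> C) (k : nat) (n : 'rV[int]_nu) : C :=
  psum (V := C_R_NormedModule) (fun i => lattice_conv (P i) (P (k - i)%N) n)
    (seq.iota 0 k.+1).

Lemma graded_conv_le k n :
  (forall i m, (i <= k)%N -> Cmod (P i m) <= A * pow M i * weight r m) ->
  Cmod (graded_conv P k n) <= (INR k + 1) * (A * A * Kconst r nu * pow M k * weight r n).
Proof.
move=> hP; rewrite -normC.
have := @norm_psum_in _ C_R_NormedModule
  (fun i => lattice_conv (P i) (P (k - i)%N) n)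
  (fun _ => A * A * Kconst r nu * pow M k * weight r n) (seq.iota 0 k.+1).
move=> h; apply: Rle_trans (h _) _.
  move=> i; rewrite mem_iota /= add0n ltnS => ik.
  rewrite normC.
  have hi m := hP i m ik; have hki m := hP (k - i)%N m (leq_subr _ _).
  apply: Rle_trans (lattice_conv_le nu0 hr hi hki n) _.
  rewrite -{2}(subnKC ik) pow_add; right; ring.
rewrite -S_INR -[X in INR X](size_iota 0 k.+1).
elim: (seq.iota _ _) => [|i l IH]; first by rewrite big_nil /=; lra.
by rewrite big_cons [size _]/= S_INR; lra.
Qed.

Hypothesis hP : forall k n, Cmod (P k n) <= A * pow M k * weight r n.

Lemma exp_growth_coef : exp_growth M (weight r) P.
Proof.
move=> b Mb; exists A; split=> // k n; apply: Rle_trans (hP k n) _.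
apply: Rmult_le_compat_r; first exact: weight_ge0.
by apply: Rmult_le_compat_l => //; apply: pow_incr; lra.
Qed.

(** The number [k + 1] of pairs of degrees is absorbed by a slightly larger
    ratio. *)
Lemma exp_growth_conv : exp_growth M (weight r) (graded_conv P).
Proof.
move=> b Mb; have [|e [e0 he]] := @linear_geometric_le M b; first lra.
have K0 := Kconst_ge0 nu0 hr.
exists (A * A * Kconst r nu * e); split.
  by do 3 apply: Rmult_le_pos => //.
move=> k n; apply: Rle_trans (graded_conv_le n (fun i m _ => hP i m)) _.
have -> : (INR k + 1) * (A * A * Kconst r nu * pow M k * weight r n)
  = (A * A * Kconst r nu * weight r n) * ((INR k + 1) * pow M k) by ring.
have -> : A * A * Kconst r nu * e * pow b k * weight r n
  = (A * A * Kconst r nu * weight r n) * (e * pow b k) by ring.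
apply: Rmult_le_compat_l => //.
by do ?[exact: weight_ge0|apply: Rmult_le_pos => //].
Qed.

(** The product of the double series is regrouped along addition in
    [N x Z^nu].  The packet of [(k, n)] splits, according to the degree [i] of
    the first factor, into finitely many copies of the lattice. *)
Lemma pseries_square t x : Rabs t <= radius M ->
  pseries omega (graded_conv P) t x = Cmult (pseries omega P t x) (pseries omega P t x).
Proof.
move=> tr; have sw := summable_weight nu0 hr.
have [B sB hB] := pterm_bound omega M1 sw exp_growth_coef.
have hu := pseries_usum omega M1 x sw exp_growth_coef tr.
have hB' := fun p => hB t x p tr.
have hm := is_usum_mult sB sB hB' hB' hu hu.
have hg := pseries_usum omega M1 x sw exp_growth_conv tr.
apply: (is_usum_unique hg).
pose pi (p : (nat * 'rV[int]_nu) * (nat * 'rV[int]_nu)) :=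
  ((p.1.1 + p.2.1)%N, (p.1.2 + p.2.2)%R).
apply: (is_usum_regroup (pi := pi) (summable_prod sB sB) _ hm).
  move=> p; rewrite normC Cmod_mult.
  by apply: Rmult_le_compat => //; exact: Cmod_ge_0.
move=> [k n].
pose F (i : nat) (p : (nat * 'rV[int]_nu) * (nat * 'rV[int]_nu)) : C :=
  if [&& p.1.1 == i, p.2.1 == (k - i)%N & (p.1.2 + p.2.2)%R == n]
  then Cmult (pterm omega P t x p.1) (pterm omega P t x p.2) else RtoC 0.
pose a := Cmult (mode omega n (RtoC 1) x) (RtoC (pow t k)).
have hF i : i \in seq.iota 0 k.+1 -> is_usum (V := C_R_NormedModule) (F i)
    (Cmult a (lattice_conv (P i) (P (k - i)%N) n)).
  rewrite mem_iota /= add0n ltnS => ik.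
  apply: (is_usum_reindex (phi := fun m => ((i, m), ((k - i)%N, (n - m)%R)))
    (psi := fun p => p.1.2)) => //.
    move=> [[i1 m1] [i2 m2]] /= hne; rewrite /F /=.
    case: and3P => // -[/eqP e1 /eqP e2 /eqP e3]; case/negP: hne.
    by rewrite e1 e2 -e3 addrC addKr.
  have := is_usum_Cmult a (lattice_conv_usum nu0 hr (hP i) (hP (k - i)%N) n).
  apply: is_usum_ext => m; rewrite /F /=.
  have e : (m + (n - m))%R = n by rewrite addrC subrK.
  rewrite e !eqxx /= /pterm /= mode_mult e mode_scal /a.
  rewrite -{1}(subnKC ik) pow_add RtoC_mult.
  have shuffle (e0 e1 e2 p q : C) : Cmult (Cmult e0 (Cmult e1 e2)) (Cmult p q)
      = Cmult e0 (Cmult (Cmult p e1) (Cmult q e2)) by ring.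
  exact: shuffle.
have := is_usum_psum hF.
rewrite psum_morph; last 2 first.
- exact: Cmult_0_r.
- by move=> u v; exact: Cmult_plus_distr_l.
rewrite -/(graded_conv P k n).
have -> : pterm omega (graded_conv P) t x (k, n) = Cmult a (graded_conv P k n).
  by rewrite /pterm mode_scal /a /=; ring.
apply: is_usum_ext => p.
rewrite /pi; case: eqP => [[e1 e2]|ne]; last first.
  apply: psum0 => i; rewrite mem_iota /= add0n ltnS => ik.
  rewrite /F; case: and3P => // -[/eqP e1 /eqP e2 /eqP e3]; case: ne.
  by rewrite e1 e2 e3 subnKC.
have pk : (p.1.1 <= k)%N by rewrite -e1 leq_addr.
rewrite (psum_filter (p := pred1 p.1.1)); last first.
  by move=> i _ /=; rewrite /F eq_sym => /negbTE ->.
rewrite filter_pred1_uniq ?iota_uniq ?mem_iota //=.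
rewrite psum_cons psum_nil plus_zero_r /F eqxx e2 eqxx.
by rewrite -e1 addKn eqxx.
Qed.

End GradedConvolution.

(** * Existence *)

Lemma time_filter_proper (T t : R) : 0 <= t <= T ->
  ProperFilter (within (time_interval T) (locally (t : R_UniformSpace))).
Proof.
move=> tT; have FF := nbhs_filter t.
split; last exact: within_filter.
move=> P [e h]; exists t; apply: h => //; exact: ball_center.
Qed.

Section Existence.
Variables (nu : nat) (omega : 'rV[R]_nu) (c d : 'rV[int]_nu -> C) (A r : R).
Hypotheses (nu0 : (0 < nu)%N) (A0 : 0 < A) (hr : INR nu + 2 < r).
Hypotheses (hc : forall n, Cmod (c n) <= A * weight r n)
           (hd : forall n, Cmod (d n) <= A * weight r n).
Local Notation M := (Mconst A r nu).
Local Notation L := (lifespan A r nu).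

Let hr' : INR nu < r. Proof. lra. Qed.
Let M1 : 1 <= M. Proof. exact: Rmax_l. Qed.
Let AKM : A * Kconst r nu <= M. Proof. exact: Rmax_r. Qed.

(** The multiplier of [(1 - dxx)^-1 (- dxx)]. *)
Definition symbol (n : 'rV[int]_nu) : R :=
  pairing n omega * pairing n omega / (1 + pairing n omega * pairing n omega).

Lemma symbol01 n : 0 <= symbol n <= 1.
Proof.
rewrite /symbol; set s := _ * _; have s0 : 0 <= s by rewrite /s; nra.
split; first by apply: Rdiv_le_0_compat; lra.
by apply: (Rmult_le_reg_r (1 + s)); [lra|rewrite /Rdiv Rmult_assoc Rinv_l; lra].
Qed.

(** The recursion for the Taylor coefficients as an operator on whole sequences
    of which they are the fixed point; the [k]-th output depends on earlier
    terms only, which makes the iterates stabilise. *)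
Definition taylor_step (p : nat -> 'rV[int]_nu -> C) (k : nat) :
    'rV[int]_nu -> C :=
  match k with
  | 0%N => c
  | 1%N => d
  | j.+2 => fun n =>
      Cmult (RtoC (- (symbol n / ((INR j + 2) * (INR j + 1)))))
        (Cplus (p j n) (graded_conv p j n))
  end.

Definition taylor_coef (k : nat) : 'rV[int]_nu -> C :=
  iter k.+1 taylor_step (fun _ _ => RtoC 0) k.

Lemma taylor_step_local p p' k :
  (forall i, (i < k)%N -> p i = p' i) -> taylor_step p k = taylor_step p' k.
Proof.
case: k => [|[|k]] // h /=; apply: functional_extensionality => n.
rewrite (h k); last by rewrite ltnW.
congr (Cmult _ (Cplus _ _)); apply: eq_psum => i.
rewrite mem_iota /= add0n ltnS => ik.
rewrite (h i); last by apply: (leq_ltn_trans ik); rewrite ltnW.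
rewrite (h (k - i)%N) //.
by apply: (leq_ltn_trans (leq_subr _ _)); rewrite ltnW.
Qed.

Lemma taylor_iter j k : (k < j)%N ->
  iter j taylor_step (fun _ _ => RtoC 0) k = taylor_coef k.
Proof.
elim/ltn_ind: k j => k IH [//|j] kj; rewrite /taylor_coef /=.
apply: taylor_step_local => i ik.
by rewrite IH // ?IH // (leq_trans ik).
Qed.

Lemma taylor_coefE k : taylor_coef k = taylor_step taylor_coef k.
Proof.
by rewrite /taylor_coef /=; apply: taylor_step_local => i ik; rewrite taylor_iter.
Qed.

(** The induction step reduces to [1 + (k+1) A K <= (k+1)(k+2) M^2], which holds
    because [M] bounds both [1] and [A K]. *)
Lemma taylor_coef_bound k n : Cmod (taylor_coef k n) <= A * pow M k * weight r n.
Proof.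
elim/ltn_ind: k n => -[|[|k]] IH n; rewrite taylor_coefE.
- by rewrite /= Rmult_1_r.
- apply: (Rle_trans _ _ _ (hd n)) => /=; have := weight_ge0 r n.
  by move=> w0; apply: Rmult_le_compat_r => //; nra.
rewrite [taylor_step _ _]/= Cmod_mult Cmod_R.
have k0 := pos_INR k; have [b0 b1] := symbol01 n.
set den := (INR k + 2) * (INR k + 1).
have den0 : 0 < den by rewrite /den; nra.
rewrite Rabs_Ropp Rabs_pos_eq; last by apply: Rdiv_le_0_compat.
have w0 := weight_ge0 r n.
have Mk : 0 < pow M k by apply: pow_lt; lra.
have h1 : Cmod (taylor_coef k n) <= A * pow M k * weight r n by apply: IH; rewrite ltnW.
have h2 : Cmod (graded_conv taylor_coef k n)
    <= (INR k + 1) * (A * A * Kconst r nu * pow M k * weight r n).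
  apply: (graded_conv_le nu0 hr').
  by move=> i m ik; apply: IH; rewrite ltnW.
have h3 := Cmod_triangle (taylor_coef k n) (graded_conv taylor_coef k n).
have X0 : 0 <= A * pow M k * weight r n.
  by apply: Rmult_le_pos => //; apply: Rmult_le_pos; lra.
set X := A * pow M k * weight r n in h1 X0.
have e2 : (INR k + 1) * (A * A * Kconst r nu * pow M k * weight r n)
  = (INR k + 1) * (A * Kconst r nu) * X by rewrite /X; ring.
have e3 : A * pow M k.+2 * weight r n = M * M * X by rewrite /X /=; ring.
rewrite e2 in h2; rewrite e3.
have h4 : Cmod (Cplus (taylor_coef k n) (graded_conv taylor_coef k n))
    <= (1 + (INR k + 1) * M) * X.
  have : (INR k + 1) * (A * Kconst r nu) * X <= (INR k + 1) * M * X.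
    apply: Rmult_le_compat_r => //; apply: Rmult_le_compat_l => //; lra.
  lra.
have h5 : symbol n / den <= / den.
  have : 0 < / den by exact: Rinv_0_lt_compat.
  rewrite /Rdiv; move: (/ den) (symbol n) b0 b1 => y b *; nra.
apply: (Rle_trans _ (/ den * ((1 + (INR k + 1) * M) * X))).
  apply: Rmult_le_compat => //; last exact: Cmod_ge_0.
  by apply: Rdiv_le_0_compat.
apply: (Rmult_le_reg_l den) => //.
rewrite -Rmult_assoc Rinv_r; last lra.
rewrite Rmult_1_l -Rmult_assoc; apply: Rmult_le_compat_r => //.
have : 1 <= M * M by nra.
have : M <= M * M by nra.
rewrite /den; nra.
Qed.

Let Lr : L < radius M.
Proof.
rewrite /lifespan /radius /Rdiv Rmult_1_l.
by apply: Rinv_lt_contravar; nra.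
Qed.

Let L0 : 0 < L.
Proof. by apply: Rdiv_lt_0_compat; lra. Qed.

Lemma is_dt_pseries W al : summable W -> exp_growth M W al ->
  is_dt L (pseries omega al) (pseries omega (coef_dt al)).
Proof.
move=> sW h t x [t0 tL].
apply: (@filterdiff_locally R_AbsRing R_NormedModule C_R_NormedModule _
  (time_filter_proper (conj t0 tL)) _ t).
  have FF := nbhs_filter t.
  exact: (@filter_le_within _ _ FF).
apply: (pseries_dt omega M1 x sW h).
by rewrite Rabs_pos_eq //; lra.
Qed.

Lemma is_dx_pseries W al : summable (fun n => bracket n * W n) ->
  (forall n, 0 <= W n) -> exp_growth M W al ->
  is_dx L (pseries omega al) (pseries omega (coef_dx omega al)).
Proof.
move=> sW W0 h t x [t0 tL]; have tr : Rabs t <= radius M by rewrite Rabs_pos_eq //; lra.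
exact: (pseries_dx omega M1 x sW W0 h tr).
Qed.

Definition time_coef (al : nat -> 'rV[int]_nu -> C) (t : R) (n : 'rV[int]_nu) : C :=
  usum (V := C_R_CompleteNormedModule)
    (fun k => Cmult (al k n) (RtoC (pow t k))).

Lemma time_coef_usum W al t n : summable W -> exp_growth M W al -> Rabs t <= radius M ->
  is_usum (V := C_R_NormedModule)
    (fun k => Cmult (al k n) (RtoC (pow t k))) (time_coef al t n).
Proof.
move=> sW h tr; have [B sB hB] := pterm_bound omega M1 sW h.
have inj : injective (fun k : nat => (k, n)) by move=> k k' [].
apply: (is_usum_usum (V := C_R_CompleteNormedModule) (summable_inj inj sB)) => k.
have := hB t 0 (k, n) tr; rewrite Cmod_pterm /= => h1.
by apply: Rle_trans h1; right; rewrite RPow_abs -Cmod_R -Cmod_mult -normC.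
Qed.

(** Regrouping by the spatial mode. *)
Lemma fourier_sum_pseries W al t x : summable W -> exp_growth M W al ->
  Rabs t <= radius M ->
  is_fourier_sum omega (time_coef al t) x (pseries omega al t x).
Proof.
move=> sW h tr; have [B sB hB] := pterm_bound omega M1 sW h.
have hs := pseries_usum omega M1 x sW h tr.
apply: (is_usum_regroup (pi := snd) sB _ hs) => [p|n].
  by rewrite normC; apply: hB.
apply: (is_usum_reindex (phi := fun k => (k, n)) (psi := fst)) => //=.
  by move=> [k m] /= hne; case: eqP => // e; case/negP: hne; rewrite e.
rewrite mode_scal.
apply: is_usum_ext (is_usum_Cmult (mode omega n (RtoC 1) x)
  (time_coef_usum n sW h tr)) => k /=.
by rewrite eqxx /pterm /= -mode_scal.
Qed.

Lemma time_coef_at0 al n : time_coef al 0 n = al 0%N n.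
Proof.
apply: (usumP (V := C_R_CompleteNormedModule)).
have := @is_usum_finite _ C_R_NormedModule
  (fun k => Cmult (al k n) (RtoC (pow 0 k))) [:: 0%N] isT.
rewrite psum_cons psum_nil plus_zero_r /= Cmult_1_r; apply=> -[|k] //= _.
by rewrite Rmult_0_l Cmult_0_r.
Qed.

Lemma time_coef_decay : has_decay L A r (time_coef taylor_coef).
Proof.
move=> t n [t0 tL]; have w0 := weight_ge0 r n.
have sw := summable_weight nu0 hr'.
have gP := exp_growth_coef M1 (Rlt_le _ _ A0) taylor_coef_bound.
have tr : Rabs t <= radius M by rewrite Rabs_pos_eq //; lra.
have Aw : 0 <= A * weight r n by apply: Rmult_le_pos; lra.
rewrite -normC; apply: (is_usum_norm_le (B := fun k => A * weight r n * pow (/ 5) k)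
  (time_coef_usum n sw gP tr)) => [k|l ul].
  rewrite normC Cmod_mult Cmod_R -RPow_abs Rabs_pos_eq //.
  apply: (Rle_trans _ (A * pow M k * weight r n * pow L k)).
    apply: Rmult_le_compat; [exact: Cmod_ge_0|exact: pow_le|exact: taylor_coef_bound|].
    exact: pow_incr.
  have -> : / 5 = M * L by rewrite /lifespan; field; lra.
  by rewrite Rpow_mult_distr; right; ring.
rewrite rsum_mulr.
have : \big[Rplus/0]_(k <- l) pow (/ 5) k <= / (1 - / 5).
  have q01 : 0 <= / 5 < 1 by lra.
  have [h0 _] := summable_geometric q01.
  apply: Rle_trans (geometric_rsum_le (\max_(k <- l) k).+1 q01).
  apply: rsum_subset => //; first exact: iota_uniq.
  move=> k kl; rewrite mem_iota /= add0n ltnS.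
  exact: leq_bigmax_seq.
by nra.
Qed.

Lemma taylor_coef_equation k n :
  Cplus (Cminus (Cminus (coef_dt (coef_dt taylor_coef) k n)
        (coef_dx omega (coef_dx omega taylor_coef) k n))
      (coef_dt (coef_dt (coef_dx omega (coef_dx omega taylor_coef))) k n))
    (Copp (coef_dx omega (coef_dx omega (graded_conv taylor_coef)) k n)) = RtoC 0.
Proof.
rewrite /coef_dt /coef_dx (taylor_coefE k.+2) [taylor_step _ _]/= S_INR.
set la := pairing n omega; set p := taylor_coef k n; set q := graded_conv taylor_coef k n.
have k0 := pos_INR k; have s0 : 0 <= la * la by nra.
have ii z : Cmult (0, la) (Cmult (0, la) z) = Cmult (RtoC (- (la * la))) z.
  by case: z => z1 z2; rewrite /Cmult /RtoC /=; congr (_, _); ring.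
rewrite !ii.
set X := Cmult (RtoC (- _)) (Cplus p q).
transitivity (Cplus (Cmult (RtoC ((INR k + 1) * (INR k + 1 + 1) * (1 + la * la))) X)
  (Cmult (RtoC (la * la)) (Cplus p q))).
  by rewrite !RtoC_mult !RtoC_plus !RtoC_opp !RtoC_mult; ring.
rewrite /X Cmult_assoc -RtoC_mult -Cmult_plus_distr_r -RtoC_plus.
rewrite (_ : _ + la * la = 0); first by ring.
by rewrite /symbol -/la; field; lra.
Qed.

Lemma pseries_solution :
  is_quasiperiodic_solution L omega c d (pseries omega taylor_coef) (time_coef taylor_coef).
Proof.
have sw := summable_weight nu0 hr'.
have w0 (n : 'rV[int]_nu) := weight_ge0 r n.
have w1 (n : 'rV[int]_nu) : 0 <= bracket n * weight r n.
  by have := bracket_ge1 n; have := w0 n; move=> *; nra.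
have sw2 : summable (fun n : 'rV[int]_nu => bracket n * (bracket n * weight r n)).
  apply: (summable_le (B' := fun n => weight (r - 2) n)).
    move=> n; rewrite -weight_bracket2; have := bracket_ge1 n; have := w0 n.
    by move=> *; split; [nra|lra].
  by apply: summable_weight => //; lra.
have sw1 : summable (fun n : 'rV[int]_nu => bracket n * weight r n).
  apply: (summable_le _ sw2) => n; split=> //.
  by have := bracket_ge1 n; have := w1 n; move=> *; nra.
have gP := exp_growth_coef M1 (Rlt_le _ _ A0) taylor_coef_bound.
have gQ := exp_growth_conv nu0 hr' M1 (Rlt_le _ _ A0) taylor_coef_bound.
have gP1 := exp_growth_dx omega w0 gP.
have gP2 := exp_growth_dx omega w1 gP1.
have gQ1 := exp_growth_dx omega w0 gQ.
have gQ2 := exp_growth_dx omega w1 gQ1.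
have w2 (n : 'rV[int]_nu) : 0 <= bracket n * (bracket n * weight r n) by case: sw2.
have gS := exp_growth_dt M1 w0 gP; have gSS := exp_growth_dt M1 w0 gS.
have gS2 := exp_growth_dt M1 w2 gP2; have gSS2 := exp_growth_dt M1 w2 gS2.
have LR := Rlt_le _ _ Lr.
have inr t : time_interval L t -> Rabs t <= radius M.
  by move=> [t0 tL]; rewrite Rabs_pos_eq; lra.
have sq t x : time_interval L t ->
    pseries omega (graded_conv taylor_coef) t x
    = Cmult (pseries omega taylor_coef t x) (pseries omega taylor_coef t x).
  move=> ht; apply: (pseries_square omega nu0 hr' M1 (Rlt_le _ _ A0)).
    exact: taylor_coef_bound.
  exact: inr.
split; first by move=> t x ht; apply: (fourier_sum_pseries x sw gP (inr t ht)).
exists (pseries omega (coef_dt taylor_coef)), (pseries omega (coef_dt (coef_dt taylor_coef))),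
  (pseries omega (coef_dx omega (coef_dx omega taylor_coef))),
  (pseries omega (coef_dt (coef_dt (coef_dx omega (coef_dx omega taylor_coef))))),
  (pseries omega (coef_dx omega (coef_dx omega (graded_conv taylor_coef)))).
split; [split; [|split; [|split; [|split]]]|split; [|split; [|split]]].
- exact: (is_dt_pseries sw gP).
- exact: (is_dt_pseries sw gS).
- exists (pseries omega (coef_dx omega taylor_coef)); split.
    exact: (is_dx_pseries sw1 w0 gP).
  exact: (is_dx_pseries sw2 w1 gP1).
- exists (pseries omega (coef_dt (coef_dx omega (coef_dx omega taylor_coef)))); split.
    exact: (is_dt_pseries sw2 gP2).
  exact: (is_dt_pseries sw2 gS2).
- exists (pseries omega (coef_dx omega (graded_conv taylor_coef))); split.
    move=> t x ht; apply: (is_derive_ext (pseries omega (graded_conv taylor_coef) t)).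
      by move=> y; exact: sq.
    exact: (is_dx_pseries sw1 w0 gQ).
  exact: (is_dx_pseries sw2 w1 gQ1).
- by split; [|split; [|split; [|split]]];
    [exact: (pseries_continuous M1 LR sw gS)|exact: (pseries_continuous M1 LR sw gSS)
    |exact: (pseries_continuous M1 LR sw2 gP2)|exact: (pseries_continuous M1 LR sw2 gSS2)
    |exact: (pseries_continuous M1 LR sw2 gQ2)].
- move=> t x ht; have tr := inr t ht.
  have h1 := pseries_usum omega M1 x sw gSS tr.
  have h2 := pseries_usum omega M1 x sw2 gP2 tr.
  have h3 := pseries_usum omega M1 x sw2 gSS2 tr.
  have h4 := pseries_usum omega M1 x sw2 gQ2 tr.
  have h := is_usum_minus (is_usum_minus (is_usum_minus h1 h2) h3) h4.
  apply: (is_usum_unique h); apply: is_usum_ext (is_usum0 _ _) => -[k n].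
  transitivity (mode omega n (Cmult (RtoC 0) (RtoC (pow t k))) x).
    by rewrite Cmult_0_l mode_scal Cmult_0_r.
  rewrite -(taylor_coef_equation k n) /pterm /mode -/(cis _) /=.
  have dist (e z a b c' d' : C) :
    Cmult (Cmult (Cplus (Cminus (Cminus a b) c') (Copp d')) z) e =
    Cminus (Cminus (Cminus (Cmult (Cmult a z) e) (Cmult (Cmult b z) e))
      (Cmult (Cmult c' z) e)) (Cmult (Cmult d' z) e) by ring.
  exact: dist.
- move=> x; have := fourier_sum_pseries (t := 0) x sw gP (inr 0 _).
  move=> h; apply: is_usum_ext (h _) => [n|]; last by split; lra.
  by rewrite time_coef_at0.
- move=> x; have := fourier_sum_pseries (t := 0) x sw gS (inr 0 _).
  move=> h; apply: is_usum_ext (h _) => [n|]; last by split; lra.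
  by rewrite time_coef_at0 /coef_dt /= Rplus_0_l Cmult_1_l.
Qed.

End Existence.

(** * Taylor's formula on a closed interval *)

Local Notation strip_nbhs L t := (within (time_interval L) (locally (t : R_UniformSpace))).

Section OneSidedCalculus.
Variable L : R.

Definition clamp (y : R) : R := Rmax 0 (Rmin L y).

Lemma clamp_id y : 0 <= y <= L -> clamp y = y.
Proof. by move=> yL; rewrite /clamp Rmin_right; [rewrite Rmax_right|]; lra. Qed.

Lemma clamp_in y : 0 <= L -> 0 <= clamp y <= L.
Proof.
move=> L0; rewrite /clamp; split; first exact: Rmax_l.
by apply: Rmax_lub => //; exact: Rmin_l.
Qed.

Lemma clamp_dist y z : 0 <= y <= L -> Rabs (clamp z - y) <= Rabs (z - y).
Proof.
move=> yL; rewrite /clamp /Rmax /Rmin.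
by repeat destruct Rle_dec; rewrite /Rabs; repeat destruct Rcase_abs; lra.
Qed.

(** Composing with [clamp] extends the function to a continuous function on the
    line, without changing it in the interior, where the one-sided derivative is
    an ordinary one; the usual mean value theorem then applies. *)
Lemma mvt_within (f f' : R -> R) :
  (forall t, 0 <= t <= L -> filterdiff (U := R_NormedModule)
    (V := R_NormedModule) f (strip_nbhs L t) (fun h => scal h (f' t))) ->
  forall t, 0 <= t <= L -> exists2 xi, 0 <= xi <= t & f t - f 0 = f' xi * t.
Proof.
move=> df t [t0 tL]; have L0 : 0 <= L by lra.
have [xi [hxi e]] : exists xi, Rmin 0 t <= xi <= Rmax 0 t /\
    f (clamp t) - f (clamp 0) = f' xi * (t - 0).
  apply: (MVT_gen (fun y => f (clamp y)) 0 t f').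
    rewrite Rmin_left // Rmax_right // => x [x0 xt].
    have inI : locally x (fun y => 0 <= y <= L).
      have e0 : 0 < Rmin x (L - x) by apply: Rmin_glb_lt; lra.
      exists (mkposreal _ e0) => y /=; rewrite /ball /= /AbsRing_ball /=.
      rewrite /abs /minus /plus /opp /=.
      have := Rmin_l x (L - x); have := Rmin_r x (L - x).
      by move=> ? ? /Rabs_lt_between ?; lra.
    apply: (is_derive_ext_loc f (fun y => f (clamp y)) x (f' x)).
      by apply: (@filter_imp _ _ (nbhs_filter x) _ _ _ inI) => y yI; rewrite clamp_id.
    have [|lin h] := df x _; first lra.
    split=> // x' hx'; rewrite -(is_filter_lim_locally_unique x x' hx') => eps.
    have [|e1 h1] := h x _ eps.
      by move=> P hP; exact: (@filter_le_within _ _ (nbhs_filter x)).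
    have e1' : locally x (ball x e1) by exists e1.
    have inE := @filter_and _ _ (nbhs_filter x) _ _ inI e1'.
    apply: (@filter_imp _ _ (nbhs_filter x) _ _ _ inE) => y [yI ye].
    exact: h1.
  rewrite Rmin_left // Rmax_right // => y [y0 yt].
  have yI : 0 <= y <= L by lra.
  apply/continuity_pt_filterlim; rewrite (clamp_id yI).
  apply: (filterlim_comp _ _ _ clamp f _ (strip_nbhs L y)).
    move=> P [e h]; exists e => z hz; apply: h; last exact: clamp_in.
    exact: Rle_lt_trans (clamp_dist z yI) hz.
  apply: filterdiff_continuous_aux.
    by eexists; exact: (df y yI).
  by move=> P hP; exact: (@filter_le_within _ _ (nbhs_filter y)).
exists xi; first by move: hxi; rewrite Rmin_left // Rmax_right.
by rewrite -(clamp_id (conj t0 tL)) -{1}(clamp_id (conj (Rle_refl 0) L0)) e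
  (clamp_id (conj t0 tL)); ring.
Qed.

Lemma taylor_within (f f' f'' : R -> R) G :
  (forall t, 0 <= t <= L -> filterdiff (U := R_NormedModule)
    (V := R_NormedModule) f (strip_nbhs L t) (fun h => scal h (f' t))) ->
  (forall t, 0 <= t <= L -> filterdiff (U := R_NormedModule)
    (V := R_NormedModule) f' (strip_nbhs L t) (fun h => scal h (f'' t))) ->
  (forall t, 0 <= t <= L -> Rabs (f'' t) <= G) -> f 0 = 0 ->
  forall t, 0 <= t <= L -> Rabs (f t - t * f' 0) <= G * t * t.
Proof.
move=> df df' bG f0 t [t0 tL].
have [xi [x0 xt] e] := mvt_within df (conj t0 tL).
have [|xj [y0 yx] e'] := mvt_within df' (t := xi); first lra.
have -> : f t - t * f' 0 = f'' xj * xi * t by rewrite f0 in e; nra.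
rewrite !Rabs_mult (Rabs_pos_eq xi) // (Rabs_pos_eq t) //.
apply: Rmult_le_compat_r => //.
have h : Rabs (f'' xj) <= G by apply: bG; lra.
by have := Rabs_pos (f'' xj); nra.
Qed.

Lemma Cmod_le_sum (z : C) : Cmod z <= Rabs z.1 + Rabs z.2.
Proof.
have h1 := Rabs_pos z.1; have h2 := Rabs_pos z.2.
apply: Rsqr_incr_0_var; last lra.
rewrite /Cmod Rsqr_sqrt /=; last by nra.
rewrite /Rsqr; have := Rsqr_abs z.1; have := Rsqr_abs z.2; rewrite /Rsqr.
by nra.
Qed.

Lemma Im_le_Cmod (z : C) : Rabs z.2 <= Cmod z.
Proof. by apply: Rle_trans (Rmax_Cmod z); exact: Rmax_r. Qed.

(** The combination [s f(t) - t f(s)] is free of the initial slope.  The factor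
    [2] is the price of treating real and imaginary parts separately. *)
Lemma taylor_within_C (f f' f'' : R -> C) G :
  (forall t, 0 <= t <= L -> filterdiff (U := R_NormedModule)
    (V := C_R_NormedModule) f (strip_nbhs L t) (fun h => scal h (f' t))) ->
  (forall t, 0 <= t <= L -> filterdiff (U := R_NormedModule)
    (V := C_R_NormedModule) f' (strip_nbhs L t) (fun h => scal h (f'' t))) ->
  (forall t, 0 <= t <= L -> Cmod (f'' t) <= G) -> f 0 = RtoC 0 ->
  forall s t, 0 <= s <= L -> 0 <= t <= L ->
    Cmod (Cminus (Cmult (RtoC s) (f t)) (Cmult (RtoC t) (f s)))
      <= 2 * G * (s * t) * (s + t).
Proof.
move=> df df' bG f0.
have FW t := @within_filter _ (time_interval L) _ (nbhs_filter t).
have h1 := taylor_within (fun t ht => filterdiff_Re (FW t) (df t ht))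
  (fun t ht => filterdiff_Re (FW t) (df' t ht)) (G := G).
have h2 := taylor_within (fun t ht => filterdiff_Im (FW t) (df t ht))
  (fun t ht => filterdiff_Im (FW t) (df' t ht)) (G := G).
have main t : 0 <= t <= L ->
    Cmod (Cminus (f t) (Cmult (RtoC t) (f' 0))) <= 2 * G * t * t.
  move=> ht; apply: Rle_trans (Cmod_le_sum _) _.
  have e1 : Rabs ((f t).1 - t * (f' 0).1) <= G * t * t.
    apply: h1 => //; last by rewrite f0.
    move=> s hs; exact: Rle_trans (re_le_Cmod _) (bG s hs).
  have e2 : Rabs ((f t).2 - t * (f' 0).2) <= G * t * t.
    apply: h2 => //; last by rewrite f0.
    move=> s hs; exact: Rle_trans (Im_le_Cmod _) (bG s hs).
  rewrite /= (_ : _ + - (t * _ - 0 * _) = (f t).1 - t * (f' 0).1); last ring.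
  rewrite (_ : _ + - (t * _ + 0 * _) = (f t).2 - t * (f' 0).2); last ring.
  lra.
move=> s t hs ht.
have -> : Cminus (Cmult (RtoC s) (f t)) (Cmult (RtoC t) (f s))
   = Cminus (Cmult (RtoC s) (Cminus (f t) (Cmult (RtoC t) (f' 0))))
     (Cmult (RtoC t) (Cminus (f s) (Cmult (RtoC s) (f' 0)))) by ring.
apply: Rle_trans (Cmod_triangle _ _) _.
rewrite Cmod_opp !Cmod_mult !Cmod_R !Rabs_pos_eq; try lra.
have := main s hs; have := main t ht; set a := Cmod _; set b := Cmod _.
by move=> ha hb; nra.
Qed.

End OneSidedCalculus.

(** * Uniqueness *)

Section FourierDerivative.
Variables (nu : nat) (omega : 'rV[R]_nu).

(** The termwise differentiated series converges to a derivative of [f], and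
    derivatives are unique. *)
Lemma fourier_dx (a : 'rV[int]_nu -> C) (W : 'rV[int]_nu -> R)
    (f f' : R -> C) :
  summable (fun n => bracket n * W n) -> (forall n, Cmod (a n) <= W n) ->
  (forall x, is_fourier_sum omega a x (f x)) ->
  (forall x, is_derive (K := R_AbsRing) (V := C_R_NormedModule) f x (f' x)) ->
  forall x, is_fourier_sum omega
    (fun n => Cmult (0, pairing n omega) (a n)) x (f' x).
Proof.
move=> sW aW hf df x; have [Om Om0 hOm] := pairing_le omega.
have sB := summable_mulr Om0 sW.
have lB n : Rabs (pairing n omega) * Cmod (a n) <= Om * (bracket n * W n).
  rewrite -Rmult_assoc; apply: Rmult_le_compat => //; first exact: Rabs_pos.
  exact: Cmod_ge_0.
pose f1 n : C := mode omega n (Cmult (0, pairing n omega) (a n)) x.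
have fB n : norm (f1 n : C_R_NormedModule) <= Om * (bracket n * W n).
  by rewrite normC Cmod_mode Cmod_mult Cmod_imag.
have [s hs] := ex_usum (V := C_R_CompleteNormedModule) sB fB.
suff -> : f' x = s by [].
apply: (is_derive_C_unique (df x)).
exact: (is_derive_mode_usum (fr := id) sB lB hf hs).
Qed.

Lemma fourier_dxx r (a : 'rV[int]_nu -> C) (k : R) (f f' f'' : R -> C) :
  (0 < nu)%N -> INR nu + 2 < r ->
  (forall n, Cmod (a n) <= k * weight r n) ->
  (forall x, is_fourier_sum omega a x (f x)) ->
  (forall x, is_derive (K := R_AbsRing) (V := C_R_NormedModule) f x (f' x)) ->
  (forall x, is_derive (K := R_AbsRing) (V := C_R_NormedModule) f' x (f'' x)) ->
  forall x, is_fourier_sum omega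
    (fun n => Cmult (RtoC (- (pairing n omega * pairing n omega))) (a n)) x (f'' x).
Proof.
move=> nu0 hr ha hf df df' x; have [Om Om0 hOm] := pairing_le omega.
have k0 : 0 <= k.
  have := ha 0%R; have := weight_gt0 r (0%R : 'rV[int]_nu).
  by have := Cmod_ge_0 (a 0%R); move=> *; nra.
have sw2 : summable (fun n : 'rV[int]_nu => weight (r - 2) n).
  by apply: summable_weight => //; lra.
have w0 (n : 'rV[int]_nu) := weight_ge0 r n.
have s1 : summable (fun n : 'rV[int]_nu => bracket n * (k * weight r n)).
  apply: (summable_le _ (summable_mulr k0 sw2)) => n.
  rewrite -weight_bracket2; have b1 := bracket_ge1 n; have wn := w0 n; split.
    by apply: Rmult_le_pos; [lra|exact: Rmult_le_pos].
  rewrite (_ : bracket n * _ = k * (weight r n * bracket n)); last ring.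
  by do 2 apply: Rmult_le_compat_l => //; nra.
have s2 : summable (fun n : 'rV[int]_nu =>
    bracket n * ((Om * bracket n) * (k * weight r n))).
  apply: (summable_le _ (summable_mulr (Rmult_le_pos _ _ Om0 k0) sw2)) => n.
  rewrite -weight_bracket2; have b1 := bracket_ge1 n; have wn := w0 n; split.
    apply: Rmult_le_pos; first lra.
    by apply: Rmult_le_pos; apply: Rmult_le_pos => //; lra.
  by right; ring.
have h1 := fourier_dx s1 ha hf df.
have h2 := fourier_dx s2 _ h1 df'.
have {}h2 := h2 _ x; apply: is_usum_ext (h2 _) => [n|n]; last first.
  rewrite Cmod_mult; apply: Rmult_le_compat => //; try exact: Cmod_ge_0.
  by rewrite Cmod_imag.
rewrite Cmult_assoc; congr (mode _ _ (Cmult _ _) _).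
by rewrite /Cmult /RtoC /=; congr (_, _); ring.
Qed.

End FourierDerivative.

Lemma le_eps_mul a b D : 0 <= D ->
  (forall e, 0 < e -> a <= b + e * D) -> a <= b.
Proof.
move=> D0 h; apply: le_epsilon => e e0.
(* D may vanish, hence the shift by 1. *)
have e1 : 0 < e / (D + 1) by apply: Rdiv_lt_0_compat; lra.
apply: Rle_trans (h _ e1) _; apply: Rplus_le_compat_l.
apply: (Rmult_le_reg_r (D + 1)); first lra.
rewrite (_ : e / (D + 1) * D * (D + 1) = e * D); last by field; lra.
by apply: Rmult_le_compat_l; lra.
Qed.

Section Contraction.
Variables (nu : nat) (omega : 'rV[R]_nu) (L r : R).
Hypotheses (nu0 : (0 < nu)%N) (hr : INR nu + 2 < r) (nr : nonresonant omega).
Hypothesis L0 : 0 < L.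
Variables (z zt w wt wtt : R -> R -> C) (zh rh : R -> 'rV[int]_nu -> C).
Local Notation la2 n := (pairing n omega * pairing n omega).
Hypotheses (dz : is_dt L z zt) (dw : is_dt L w wt) (dwt : is_dt L wt wtt).
Hypotheses (z0 : forall x, z 0 x = RtoC 0) (zt0 : forall x, zt 0 x = RtoC 0)
           (w0 : forall x, w 0 x = RtoC 0).
Hypothesis hz : forall t x, 0 <= t <= L -> is_fourier_sum omega (zh t) x (z t x).
Hypothesis hw : forall t x, 0 <= t <= L ->
  is_fourier_sum omega (fun n => Cmult (RtoC (1 + la2 n)) (zh t n)) x (w t x).
Hypothesis hrt : forall t x, 0 <= t <= L ->
  is_fourier_sum omega (rh t) x (wtt t x).
Variables (N kap : R).
Hypotheses (N0 : 0 <= N) (kap0 : 0 <= kap).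
Hypothesis zN : forall t n, 0 <= t <= L -> Cmod (zh t n) <= N * weight r n.
Hypothesis rN : forall t n, 0 <= t <= L ->
  Cmod (rh t n) <= la2 n * (kap * N * weight r n).

Let la2_ge0 (n : 'rV[int]_nu) : 0 <= la2 n. Proof. nra. Qed.

Let summable_symbol : summable (fun n => (1 + la2 n) * weight r n).
Proof.
have [Om Om0 hOm] := pairing_le omega.
have sw2 : summable (fun n : 'rV[int]_nu => weight (r - 2) n).
  by apply: summable_weight => //; lra.
have c0 : 0 <= 1 + Om * Om by nra.
apply: (summable_le _ (summable_mulr c0 sw2)) => n.
have := weight_ge0 r n; rewrite -weight_bracket2.
have b1 := bracket_ge1 n => wn; split; first by have := la2_ge0 n; nra.
have h : la2 n <= Om * Om * (bracket n * bracket n).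
  have := Rsqr_abs (pairing n omega); rewrite /Rsqr => ->.
  rewrite (_ : Om * Om * _ = (Om * bracket n) * (Om * bracket n)); last ring.
  by apply: Rmult_le_compat => //; exact: Rabs_pos.
rewrite (_ : (1 + Om * Om) * _ =
  (bracket n * bracket n + Om * Om * (bracket n * bracket n)) * weight r n);
  last ring.
by apply: Rmult_le_compat_r => //; nra.
Qed.

(** A combination of point evaluations that nearly isolates the mode [n] turns
    [w] into a function of time that is close to [(1 + la2) zh] and whose second
    derivative is at most [la2 * kap * N * w_n], up to a small error.  Taylor's
    formula applies, and the factor [la2 / (1 + la2) <= 1] is dropped. *)
Lemma slope_estimate s t n : 0 <= s <= L -> 0 <= t <= L ->
  Cmod (Cminus (Cmult (RtoC s) (zh t n)) (Cmult (RtoC t) (zh s n)))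
    <= 2 * kap * N * weight r n * (s * t) * (s + t).
Proof.
move=> hs ht; set X := Cmod _.
set Y := 2 * kap * N * weight r n * (s * t) * (s + t).
have st0 : 0 <= (s * t) * (s + t) by apply: Rmult_le_pos; nra.
have wn := weight_ge0 r n.
have kN : 0 <= kap * N * weight r n by do 2 apply: Rmult_le_pos => //.
have Y0 : 0 <= Y by rewrite /Y; nra.
suff h : (1 + la2 n) * X <= la2 n * Y.
  have := la2_ge0 n; have X0 : 0 <= X by exact: Cmod_ge_0.
  move: (la2 n) h => l h l0; nra.
apply: (@le_eps_mul _ _ (2 * ((s * t) * (s + t)) + (s + t))); first lra.
move=> e e0.
have NK : 0 <= N + kap * N by nra.
have [La hLa] := evalcomb_coef_approx n nr (summable_mulr NK summable_symbol) e0.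
have FW t' := @within_filter _ (time_interval L) _
  (nbhs_filter t').
have approx_w t' : 0 <= t' <= L ->
    Cmod (Cminus (evalcomb La (w t')) (Cmult (RtoC (1 + la2 n)) (zh t' n))) <= e.
  move=> ht'; rewrite -[e]Rmult_1_l.
  apply: (hLa (fun m => Cmult (RtoC (1 + la2 m)) (zh t' m)) (w t') 1);
    [lra| |by move=> x; exact: hw].
  move=> m; rewrite Cmod_mult Cmod_R Rabs_pos_eq; last by have := la2_ge0 m; lra.
  have := zN m ht'; have := la2_ge0 m; have wm := weight_ge0 r m.
  move=> l0 hz'; rewrite Rmult_1_l.
  apply: (Rle_trans _ ((1 + la2 m) * (N * weight r m))).
    by apply: Rmult_le_compat_l => //; lra.
  have lw : 0 <= (1 + la2 m) * weight r m by apply: Rmult_le_pos => //; lra.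
  have kN' : 0 <= kap * N by exact: Rmult_le_pos.
  have := Rmult_le_pos _ _ kN' lw; lra.
have approx_r t' : 0 <= t' <= L ->
    Cmod (evalcomb La (wtt t')) <= la2 n * (kap * N * weight r n) + e.
  move=> ht'.
  have h : Cmod (Cminus (evalcomb La (wtt t')) (rh t' n)) <= 1 * e.
    apply: (hLa (rh t') (wtt t') 1); [lra| |by move=> x; exact: hrt].
    move=> m; apply: Rle_trans (rN m ht') _.
    have wm := weight_ge0 r m; have lm := la2_ge0 m; rewrite Rmult_1_l.
    have lw : 0 <= la2 m * weight r m by exact: Rmult_le_pos.
    have kN' : 0 <= kap * N by exact: Rmult_le_pos.
    have := Rmult_le_pos _ _ kN' wm; have := Rmult_le_pos _ _ N0 wm.
    have := Rmult_le_pos _ _ N0 lw; lra.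
  have := Cmod_triangle (Cminus (evalcomb La (wtt t')) (rh t' n)) (rh t' n).
  rewrite (_ : Cplus _ _ = evalcomb La (wtt t')); last by ring.
  by have := rN n ht'; lra.
have h := taylor_within_C (L := L) (f := fun t' => evalcomb La (w t'))
  (f' := fun t' => evalcomb La (wt t')) (f'' := fun t' => evalcomb La (wtt t'))
  (fun t' ht' => filterdiff_evalcomb La (FW t') (fun x => dw x ht'))
  (fun t' ht' => filterdiff_evalcomb La (FW t') (fun x => dwt x ht')) approx_r.
have {}h := h _ s t hs ht.
have {}h : Cmod (Cminus (Cmult (RtoC s) (evalcomb La (w t)))
      (Cmult (RtoC t) (evalcomb La (w s))))
    <= 2 * (la2 n * (kap * N * weight r n) + e) * (s * t) * (s + t).
  by apply: h; exact: evalcomb_eq0.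
have e1 : (1 + la2 n) * X = Cmod (Cmult (RtoC (1 + la2 n))
    (Cminus (Cmult (RtoC s) (zh t n)) (Cmult (RtoC t) (zh s n)))).
  by rewrite Cmod_mult Cmod_R Rabs_pos_eq //; have := la2_ge0 n; lra.
rewrite e1.
set a := Cmult (RtoC (1 + la2 n)) (zh t n) in approx_w *.
have at_ := approx_w t ht; have as_ := approx_w s hs.
set b := evalcomb La (w t) in h at_; set b' := evalcomb La (w s) in h as_.
have -> : Cmult (RtoC (1 + la2 n))
    (Cminus (Cmult (RtoC s) (zh t n)) (Cmult (RtoC t) (zh s n)))
  = Cplus (Cminus (Cmult (RtoC s) b) (Cmult (RtoC t) b'))
     (Cminus (Cmult (RtoC t) (Cminus b' (Cmult (RtoC (1 + la2 n)) (zh s n))))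
       (Cmult (RtoC s) (Cminus b (Cmult (RtoC (1 + la2 n)) (zh t n))))) by ring.
apply: Rle_trans (Cmod_triangle _ _) _.
have h3 := Cmod_triangle
  (Cmult (RtoC t) (Cminus b' (Cmult (RtoC (1 + la2 n)) (zh s n))))
  (Copp (Cmult (RtoC s) (Cminus b (Cmult (RtoC (1 + la2 n)) (zh t n))))).
rewrite Cmod_opp !Cmod_mult !Cmod_R !Rabs_pos_eq in h3; try lra.
rewrite -/(Cminus _ _) in h3.
have h4 : t * Cmod (Cminus b' (Cmult (RtoC (1 + la2 n)) (zh s n))) <= t * e.
  by apply: Rmult_le_compat_l => //; lra.
have h5 : s * Cmod (Cminus b (Cmult (RtoC (1 + la2 n)) (zh t n))) <= s * e.
  by apply: Rmult_le_compat_l => //; lra.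
apply: (Rle_trans _ (2 * (la2 n * (kap * N * weight r n) + e) * (s * t) * (s + t)
   + (t * e + s * e))); last by rewrite /Y; right; ring.
by apply: Rplus_le_compat => //; lra.
Qed.

Lemma coef_at0 n : Cmod (zh 0 n) <= 0.
Proof.
apply: (@le_eps_mul _ _ 1); first lra.
move=> e e0; have sw : summable (fun n : 'rV[int]_nu => weight r n).
  by apply: summable_weight => //; lra.
have [La hLa] := evalcomb_coef_approx n nr (summable_mulr N0 sw) e0.
have h0 : 0 <= 0 <= L by lra.
have h : Cmod (Cminus (evalcomb La (z 0)) (zh 0 n)) <= 1 * e.
  apply: (hLa (zh 0) (z 0) 1); [lra| |by move=> x; exact: hz].
  by move=> m; rewrite Rmult_1_l; exact: zN.
rewrite evalcomb_eq0 // in h.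
have : Cmod (zh 0 n) = Cmod (Cminus (RtoC 0) (zh 0 n)).
  by rewrite -Cmod_opp; congr Cmod; ring.
lra.
Qed.

(** Comparison of the time [s] with the final time [L]. *)
Lemma coef_linear_bound s n : 0 <= s <= L ->
  Cmod (zh s n) <= s * ((N / L + 4 * kap * N * L) * weight r n).
Proof.
move=> hs; have hL : 0 <= L <= L by lra.
have h := slope_estimate n hs hL.
have e : Cmult (RtoC L) (zh s n) = Cminus (Cmult (RtoC s) (zh L n))
  (Cminus (Cmult (RtoC s) (zh L n)) (Cmult (RtoC L) (zh s n))) by ring.
have h1 := Cmod_triangle (Cmult (RtoC s) (zh L n))
  (Copp (Cminus (Cmult (RtoC s) (zh L n)) (Cmult (RtoC L) (zh s n)))).
rewrite -/(Cminus _ _) -e Cmod_opp !Cmod_mult !Cmod_R !Rabs_pos_eq in h1; try lra.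
have h2 : s * Cmod (zh L n) <= s * (N * weight r n).
  by apply: Rmult_le_compat_l; [lra|exact: zN].
apply: (Rmult_le_reg_l L) => //.
have -> : L * (s * ((N / L + 4 * kap * N * L) * weight r n)) =
  s * (N * weight r n) + 2 * kap * N * weight r n * (s * L) * (L + L).
  by field; lra.
have h3 : 2 * kap * N * weight r n * (s * L) * (s + L)
    <= 2 * kap * N * weight r n * (s * L) * (L + L).
  apply: Rmult_le_compat_l; last lra.
  apply: Rmult_le_pos; last by nra.
  by apply: Rmult_le_pos; [nra|exact: weight_ge0].
lra.
Qed.

(** Finitely many point values of [z] are [o(s)] together, since [z] and [z_t]
    vanish at time [0]; by [coef_linear_bound] the error made in recovering the
    coefficient from them is itself a small multiple of [s]. *)
Lemma coef_sublinear n e : 0 < e -> exists s, 0 < s <= L /\ s <= e /\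
  Cmod (zh s n) <= s * e.
Proof.
move=> e0; have e2 : 0 < e / 2 by lra.
have sw : summable (fun n : 'rV[int]_nu => weight r n).
  by apply: summable_weight => //; lra.
have c0 : 0 <= N / L + 4 * kap * N * L.
  have : 0 <= N / L by apply: Rdiv_le_0_compat.
  have : 0 <= kap * N * L by apply: Rmult_le_pos; [exact: Rmult_le_pos|lra].
  lra.
have [La hLa] := evalcomb_coef_approx n nr (summable_mulr c0 sw) e2.
have h0 : 0 <= 0 <= L by lra.
have FF := nbhs_filter 0.
have FW := @within_filter _ (time_interval L) _ FF.
have dlam := filterdiff_evalcomb La FW (fun x => dz x h0).
rewrite (evalcomb_eq0 La zt0) in dlam.
have [_ dl] := dlam.
have [|del hdel] := dl 0 _ (mkposreal _ e2).
  by move=> P hP; exact: (@filter_le_within _ _ FF).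
(* s must lie in the domain, below e, and in the range where the derivative of
   the combination at 0 is effective. *)
pose s := Rmin (del / 2) (Rmin L e).
have d0 := cond_pos del.
have s0 : 0 < s.
  by apply: Rmin_glb_lt; [lra|exact: Rmin_glb_lt].
have sd : s <= del / 2 by exact: Rmin_l.
have sL : s <= L by apply: Rle_trans (Rmin_r _ _) (Rmin_l _ _).
have se : s <= e by apply: Rle_trans (Rmin_r _ _) (Rmin_r _ _).
exists s; split; first lra; split=> //.
have hs : 0 <= s <= L by lra.
have {hdel} : norm (minus
    (minus (evalcomb La (z s) : C_R_NormedModule) (evalcomb La (z 0)))
    (scal (minus s 0) (RtoC 0 : C_R_NormedModule)))
    <= e / 2 * norm (minus s 0 : R_NormedModule).
  apply: hdel => //; rewrite /ball /= /AbsRing_ball /= /abs /minus /plus /opp /=.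
  by rewrite Ropp_0 Rplus_0_r Rabs_pos_eq; lra.
rewrite (evalcomb_eq0 La z0) scal_zero_r.
have mz (a : C_R_NormedModule) : minus a zero = a by exact: minus_zero_r.
rewrite -[RtoC 0]/(zero : C_R_NormedModule) !mz normC.
rewrite /norm /= /abs /minus /plus /opp /= Ropp_0 Rplus_0_r Rabs_pos_eq; last lra.
move=> h1.
have h2 : Cmod (Cminus (evalcomb La (z s)) (zh s n)) <= s * (e / 2).
  apply: (hLa (zh s) (z s) s); [lra| |by move=> x; exact: hz].
  by move=> m; exact: coef_linear_bound.
have := Cmod_triangle (evalcomb La (z s)) (Copp (Cminus (evalcomb La (z s)) (zh s n))).
rewrite Cmod_opp (_ : Cplus _ _ = zh s n); last ring.
lra.
Qed.

(** Let [s] tend to [0] in [slope_estimate]. *)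
Lemma coef_quadratic_bound t n : 0 <= t <= L ->
  Cmod (zh t n) <= 2 * kap * N * weight r n * (t * t).
Proof.
move=> ht; have wn := weight_ge0 r n.
have c0 : 0 <= 2 * kap * N * weight r n.
  by apply: Rmult_le_pos => //; nra.
set c := 2 * kap * N * weight r n in c0 *.
have [t0|->] : 0 < t \/ t = 0 by lra.
  apply: (@le_eps_mul _ _ (t + c * t)); first by nra.
  move=> e e0; have [s [[s0 sL] [se hs]]] := coef_sublinear n e0.
  have sI : 0 <= s <= L by lra.
  have h := slope_estimate n sI ht; rewrite -/c in h.
  have e1 : Cmult (RtoC s) (zh t n) = Cplus (Cmult (RtoC t) (zh s n))
    (Cminus (Cmult (RtoC s) (zh t n)) (Cmult (RtoC t) (zh s n))) by ring.
  have h1 := Cmod_triangle (Cmult (RtoC t) (zh s n))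
    (Cminus (Cmult (RtoC s) (zh t n)) (Cmult (RtoC t) (zh s n))).
  rewrite -e1 !Cmod_mult !Cmod_R !Rabs_pos_eq in h1; try lra.
  apply: (Rmult_le_reg_l s) => //.
  have h2 : t * Cmod (zh s n) <= t * (s * e) by apply: Rmult_le_compat_l; lra.
  have h3 : c * (s * t) * (s + t) <= c * (s * t) * (e + t).
    by apply: Rmult_le_compat_l; [apply: Rmult_le_pos => //; nra|lra].
  nra.
by have := coef_at0 n; lra.
Qed.

End Contraction.

Lemma filterdiff_Cminus (F : (R -> Prop) -> Prop) (f g : R -> C) (a b : C) :
  Filter F ->
  filterdiff (U := R_NormedModule) (V := C_R_NormedModule)
    f F (fun h => scal h a) ->
  filterdiff (U := R_NormedModule) (V := C_R_NormedModule)
    g F (fun h => scal h b) ->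
  filterdiff (U := R_NormedModule) (V := C_R_NormedModule)
    (fun y => Cminus (f y) (g y)) F (fun h => scal h (Cminus a b)).
Proof.
move=> FF hf hg.
have h := @filterdiff_minus_fct R_AbsRing R_NormedModule C_R_NormedModule F FF
  _ _ _ _ hf hg.
apply: (filterdiff_ext_lin _ _ _ h) => y.
by rewrite -[Cminus a b]/(minus (a : C_R_NormedModule) b) scal_minus_distr_l.
Qed.

Lemma is_dt_minus L (f g f' g' : R -> R -> C) : is_dt L f f' -> is_dt L g g' ->
  is_dt L (fun t x => Cminus (f t x) (g t x)) (fun t x => Cminus (f' t x) (g' t x)).
Proof.
move=> hf hg t x ht.
have FW := @within_filter _ (time_interval L) _
  (nbhs_filter t).
exact: (filterdiff_Cminus FW (hf t x ht) (hg t x ht)).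
Qed.

Lemma is_dx_minus L (f g f' g' : R -> R -> C) : is_dx L f f' -> is_dx L g g' ->
  is_dx L (fun t x => Cminus (f t x) (g t x)) (fun t x => Cminus (f' t x) (g' t x)).
Proof.
move=> hf hg t x ht.
have FF := nbhs_filter x.
exact: (filterdiff_Cminus FF (hf t x ht) (hg t x ht)).
Qed.

Section Uniqueness.
Variables (nu : nat) (omega : 'rV[R]_nu) (c d : 'rV[int]_nu -> C) (A r : R).
Hypotheses (nu0 : (0 < nu)%N) (A0 : 0 < A) (hr : INR nu + 2 < r)
           (nr : nonresonant omega).
Local Notation M := (Mconst A r nu).
Local Notation L := (lifespan A r nu).
Variables (u v : R -> R -> C) (uh vh : R -> 'rV[int]_nu -> C).
Hypotheses (hu : is_quasiperiodic_solution L omega c d u uh)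
           (hv : is_quasiperiodic_solution L omega c d v vh)
           (du : has_decay L A r uh) (dv : has_decay L A r vh).

Let hr' : INR nu < r. Proof. lra. Qed.
Let M1 : 1 <= M. Proof. exact: Rmax_l. Qed.
Let AKM : A * Kconst r nu <= M. Proof. exact: Rmax_r. Qed.
Let L0 : 0 < L.
Proof. by apply: Rdiv_lt_0_compat; lra. Qed.
Let LM : 5 * M * L = 1. Proof. by rewrite /lifespan; field; lra. Qed.

Let zh t n := Cminus (uh t n) (vh t n).

(** The equation turns [w_tt], for [w = z - z_xx], into second derivatives in
    [x]; with [kap = 1 + 4 A K <= 5 M] the quadratic bound at [t <= 1 / (5 M)] has
    constant at most [2 / 5]. *)
Lemma coef_contraction N : 0 <= N ->
  (forall t n, 0 <= t <= L -> Cmod (zh t n) <= N * weight r n) ->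
  forall t n, 0 <= t <= L -> Cmod (zh t n) <= N * (2 / 5) * weight r n.
Proof.
move=> N0 hN.
have [qu [ut [utt [uxx [uxxtt [u2xx [[dut [dutt [[ux [dux duxx]]
  [[uxxt [duxxt duxxtt]] [u2x [du2x du2xx]]]]]] [_ [pdeu [icu idu]]]]]]]]]] := hu.
have [qv [vt [vtt [vxx [vxxtt [v2xx [[dvt [dvtt [[vx [dvx dvxx]]
  [[vxxt [dvxxt dvxxtt]] [v2x [dv2x dv2xx]]]]]] [_ [pdev [icv idv]]]]]]]]]] := hv.
have h0 : 0 <= 0 <= L by lra.
have K0 := Kconst_ge0 nu0 hr'.
pose z t x := Cminus (u t x) (v t x).
pose zxx t x := Cminus (uxx t x) (vxx t x).
have z0 x : z 0 x = RtoC 0.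
  have e : u 0 x = v 0 x by exact: (is_usum_unique (icu x) (icv x)).
  by rewrite /z e; ring.
have zt0 x : Cminus (ut 0 x) (vt 0 x) = RtoC 0.
  have e : ut 0 x = vt 0 x by exact: (is_usum_unique (idu x) (idv x)).
  by rewrite e; ring.
have fz t x : 0 <= t <= L -> is_fourier_sum omega (zh t) x (z t x).
  by move=> ht; exact: fourier_sum_minus (qu t x ht) (qv t x ht).
have dz1 := is_dx_minus dux dvx; have dz2 := is_dx_minus duxx dvxx.
have fzxx t x : 0 <= t <= L -> is_fourier_sum omega
    (fun n => Cmult (RtoC (- (pairing n omega * pairing n omega))) (zh t n)) x
    (zxx t x).
  move=> ht; apply: (fourier_dxx nu0 hr (fun n => hN t n ht)
    (fun y => fz t y ht) (fun y => dz1 t y ht) (fun y => dz2 t y ht)).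
(* z(0, .) vanishes identically, hence so do its derivatives in x. *)
have zxx0 x : zxx 0 x = RtoC 0.
  have c1 y : Cminus (ux 0 y) (vx 0 y) = RtoC 0.
    apply: (is_derive_C_unique (dz1 0 y h0)).
    apply: (@is_derive_ext R_AbsRing C_R_NormedModule (fun _ => RtoC 0)
      (z 0) y (RtoC 0)); first by move=> y'; rewrite z0.
    exact: is_derive_const.
  apply: (is_derive_C_unique (dz2 0 x h0)).
  apply: (@is_derive_ext R_AbsRing C_R_NormedModule (fun _ => RtoC 0)
    (fun y => Cminus (ux 0 y) (vx 0 y)) x (RtoC 0)); first by move=> y'; rewrite c1.
  exact: is_derive_const.
pose sh t n := Cplus (uh t n) (vh t n).
have shB t n : 0 <= t <= L -> Cmod (sh t n) <= 4 * A * weight r n.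
  move=> ht; have := Cmod_triangle (uh t n) (vh t n).
  by have := du n ht; have := dv n ht; rewrite -/(sh t n); lra.
pose q t x := Cminus (Cmult (u t x) (u t x)) (Cmult (v t x) (v t x)).
have fq t x : 0 <= t <= L -> is_fourier_sum omega (lattice_conv (sh t) (zh t)) x (q t x).
  move=> ht; rewrite /q (_ : Cminus _ _ = Cmult (Cplus (u t x) (v t x)) (z t x));
    last by rewrite /z; ring.
  apply: (fourier_sum_mult nu0 hr' (fun n => shB t n ht) (fun n => hN t n ht)).
    exact: fourier_sum_plus (qu t x ht) (qv t x ht).
  exact: fz.
have qB t n : 0 <= t <= L ->
    Cmod (lattice_conv (sh t) (zh t) n) <= (4 * A * N * Kconst r nu) * weight r n.
  move=> ht; apply: Rle_trans (lattice_conv_le nu0 hr' (fun n => shB t n ht)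
    (fun n => hN t n ht) n) _; right; ring.
have dq1 := is_dx_minus du2x dv2x; have dq2 := is_dx_minus du2xx dv2xx.
have fqxx t x : 0 <= t <= L -> is_fourier_sum omega
    (fun n => Cmult (RtoC (- (pairing n omega * pairing n omega)))
      (lattice_conv (sh t) (zh t) n)) x (Cminus (u2xx t x) (v2xx t x)).
  move=> ht; apply: (fourier_dxx nu0 hr (fun n => qB t n ht)
    (fun y => fq t y ht) (fun y => dq1 t y ht) (fun y => dq2 t y ht)).
pose rh t n := Cplus
  (Cmult (RtoC (- (pairing n omega * pairing n omega))) (zh t n))
  (Cmult (RtoC (- (pairing n omega * pairing n omega))) (lattice_conv (sh t) (zh t) n)).
pose kap := 1 + 4 * A * Kconst r nu.
have kap0 : 0 <= kap by rewrite /kap; nra.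
pose w t x := Cminus (z t x) (zxx t x).
pose wt t x := Cminus (Cminus (ut t x) (vt t x)) (Cminus (uxxt t x) (vxxt t x)).
pose wtt t x := Cminus (Cminus (utt t x) (vtt t x)) (Cminus (uxxtt t x) (vxxtt t x)).
have dw : is_dt L w wt.
  exact: (is_dt_minus (is_dt_minus dut dvt) (is_dt_minus duxxt dvxxt)).
have dwt : is_dt L wt wtt.
  exact: (is_dt_minus (is_dt_minus dutt dvtt) (is_dt_minus duxxtt dvxxtt)).
have w0 x : w 0 x = RtoC 0 by rewrite /w z0 zxx0; ring.
have fw t x : 0 <= t <= L -> is_fourier_sum omega (fun n =>
    Cmult (RtoC (1 + pairing n omega * pairing n omega)) (zh t n)) x (w t x).
  move=> ht; apply: is_usum_ext (fourier_sum_minus (fz t x ht) (fzxx t x ht)) => n.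
  congr mode; rewrite RtoC_plus RtoC_opp; ring.
have fr t x : 0 <= t <= L -> is_fourier_sum omega (rh t) x (wtt t x).
  move=> ht; have := fourier_sum_plus (fzxx t x ht) (fqxx t x ht).
  rewrite (_ : Cplus _ _ = wtt t x) //.
  have eu := pdeu t x ht; have ev := pdev t x ht.
  rewrite /wtt /zxx.
  transitivity (Cplus (Cminus (Cminus (utt t x) (vtt t x))
      (Cminus (uxxtt t x) (vxxtt t x)))
    (Cminus (Cminus (Cminus (Cminus (vtt t x) (vxx t x)) (vxxtt t x)) (v2xx t x))
      (Cminus (Cminus (Cminus (utt t x) (uxx t x)) (uxxtt t x)) (u2xx t x)))).
    by ring.
  by rewrite eu ev; ring.
have rB t n : 0 <= t <= L -> Cmod (rh t n)
    <= pairing n omega * pairing n omega * (kap * N * weight r n).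
  move=> ht; have l0 : 0 <= pairing n omega * pairing n omega by nra.
  rewrite /rh -Cmult_plus_distr_l Cmod_mult Cmod_R Rabs_Ropp Rabs_pos_eq //.
  apply: Rmult_le_compat_l => //; apply: Rle_trans (Cmod_triangle _ _) _.
  have := hN t n ht; have := qB t n ht; rewrite /kap; lra.
move=> t n ht.
have h := @coef_quadratic_bound nu omega L r nu0 hr nr L0 z _ w wt wtt zh rh
  (is_dt_minus dut dvt) dw dwt z0 zt0 w0 fz fw fr N kap N0 kap0 hN rB t n ht.
apply: Rle_trans h _.
have wn := weight_ge0 r n.
have kM : kap <= 5 * M by rewrite /kap; nra.
have tt : t * t <= L * L by nra.
have k1 : kap * (t * t) <= / 5.
  apply: (Rle_trans _ (5 * M * (L * L))).
    by apply: Rmult_le_compat => //; nra.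
  rewrite -Rmult_assoc LM; nra.
have Nw : 0 <= N * weight r n by exact: Rmult_le_pos.
nra.
Qed.

Lemma coef_eq0 t n : 0 <= t <= L -> zh t n = RtoC 0.
Proof.
move=> ht.
have hj (j : nat) : forall t n, 0 <= t <= L ->
    Cmod (zh t n) <= 4 * A * pow (2 / 5) j * weight r n.
  elim: j => [|j IH] s m hs.
    rewrite /= Rmult_1_r; have := Cmod_triangle (uh s m) (Copp (vh s m)).
    rewrite Cmod_opp -/(Cminus _ _) -/(zh s m).
    by have := du m hs; have := dv m hs; lra.
  have p0 : 0 <= pow (2 / 5) j by apply: pow_le; lra.
  rewrite (_ : 4 * A * _ = 4 * A * pow (2 / 5) j * (2 / 5)); last by rewrite /=; ring.
  by apply: coef_contraction => //; nra.
apply: Cmod_eq_0; apply: Rle_antisym; last exact: Cmod_ge_0.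
have wn := weight_ge0 r n.
apply: (@le_eps_mul _ _ (4 * A * weight r n)).
  by apply: Rmult_le_pos => //; lra.
move=> e e0.
have [|j hj'] := pow_lt_1_zero (2 / 5) _ e e0; first by rewrite Rabs_pos_eq; lra.
have /Rabs_lt_between h1 := hj' j (le_n _).
apply: Rle_trans (hj j t n ht) _; rewrite Rplus_0_l.
have -> : 4 * A * pow (2 / 5) j * weight r n
  = pow (2 / 5) j * (4 * A * weight r n) by ring.
apply: Rmult_le_compat_r; last lra.
by apply: Rmult_le_pos => //; lra.
Qed.

Lemma decaying_solution_unique t x : 0 <= t <= L -> v t x = u t x.
Proof.
move=> ht; have [qu _] := hu; have [qv _] := hv.
apply: (is_usum_unique (qv t x ht)).
apply: is_usum_ext (qu t x ht) => n; congr mode.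
transitivity (Cplus (zh t n) (vh t n)); first by rewrite /zh; ring.
by rewrite coef_eq0 //; ring.
Qed.

End Uniqueness.

Theorem theorem1p2 (nu : nat) (hnu : (2 <= nu)%N) (omega : 'rV[R]_nu)
    (homega : nonresonant omega) (c d : 'rV[int]_nu -> C) (A r : R)
    (hA : 0 < A) (hr : INR nu + 2 < r)
    (hc : forall n, Cmod (c n) <= A * weight r n)
    (hd : forall n, Cmod (d n) <= A * weight r n) :
  let L := lifespan A r nu in
  exists (u : R -> R -> C) (uhat : R -> 'rV[int]_nu -> C),
    is_quasiperiodic_solution L omega c d u uhat /\
    has_decay L A r uhat /\
    (forall (v : R -> R -> C) (vhat : R -> 'rV[int]_nu -> C),
      is_quasiperiodic_solution L omega c d v vhat ->
      has_decay L A r vhat ->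
      forall t x, 0 <= t <= L -> v t x = u t x).

Proof.
move=> L; have nu0 : (0 < nu)%N by apply: leq_trans hnu.
exists (pseries omega (taylor_coef omega c d)), (time_coef (taylor_coef omega c d)).
have hu := pseries_solution omega nu0 hA hr hc hd.
have hdec := time_coef_decay omega nu0 hA hr hc hd.
split; [exact: hu|split; [exact: hdec|]] => v vhat hv hvdec t x ht.
exact: (decaying_solution_unique nu0 hA hr homega hu hv hdec hvdec).
Qed.
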